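(* Let $Q(n)$ be the number of $n$-quasigroups of order $4$ on the set $A=\{0,1,2,3\}$. Then for every natural number $n\ge 1$, $$Q(n) \leq 4 \cdot 6^n \cdot 3^{\binom{n}{\lfloor n/2\rfloor}} \cdot 2^{2^n},$$ and the right-hand side equals $2^{2^n (1 + O(1/\sqrt{n}))}$ as $n\to\infty$.
   Context: Let $A=\{0,1,2,3\}$. For a natural number $n$, an $n$-quasigroup (of order $4$) is a pair $(A,q)$ where $q:A^n\to A$ satisfies $q(c)\neq q(c')$ for all $c,c'\in A^n$ that differ in exactly one coordinate. $Q(n)$ denotes the number of different $n$-quasigroups $(A,q)$, i.e. the number of such maps $q$ (not up to equivalence). *)

(* Defs.v *)
From mathcomp Require Import all_boot.

Set Implicit Arguments.
Unset Strict Implicit.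
Unset Printing Implicit Defensive.

(* The set A = {0,1,2,3} is 'I_4; A^n is {ffun 'I_n -> 'I_4}. *)

Definition differ_in_one n (c c' : {ffun 'I_n -> 'I_4}) : bool :=
  #|[set i | c i != c' i]| == 1.

Definition is_quasigroup n (q : {ffun {ffun 'I_n -> 'I_4} -> 'I_4}) : bool :=
  [forall c, forall c', differ_in_one c c' ==> (q c != q c')].

Definition Q n : nat :=
  #|[set q : {ffun {ffun 'I_n -> 'I_4} -> 'I_4} | is_quasigroup q]|.

(* Main.v *)
Require Import Defs.
From mathcomp Require Import all_boot.
From mathcomp Require Import zify.
From mathcomp Require boolp.

Set Implicit Arguments.
Unset Strict Implicit.
Unset Printing Implicit Defensive.

(* Identify A with F_2^2 and call a quasigroup semilinear on a box if, after one of the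
   three nonzero functionals on F_2^2, it is a sum of functions of one coordinate. Order the
   faces of A^n through the origin by the sets T of free coordinates. The quasigroup is
   determined by its values on the axes (at most 4 * 6^n possibilities) and, for each T
   with at least two elements, by the choice of its restriction to the face T among the
   extensions of its restrictions to the sides of T.

   Two different extensions are both semilinear. If every line meets the set where they
   differ in fewer than 3 points, this set contains a product of pairs on which each of
   them takes only two values, and the complementary pair of values propagates from
   there. Otherwise, in dimension at least 4, the semilinearity of the lower dimensional
   layers yields such a product; dimensions 2 and 3 are checked on the 4 normalized Latin
   squares and the 64 normalized Latin cubes. At most two of the extensions are
   semilinear for a given functional. Hence a face has at most 2 extensions, unless all
   its sides are affine, when it has at most one affine extension and one non-affine
   extension for each of the 3 functionals.

   Along a chain of k faces the quasigroup is affine, then leaves the affine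
   ones in one of 3 ways, and then has 2 choices at each step: fewer than 3 * 2^k
   possibilities. The faces are partitioned into 'C(n, n %/ 2) symmetric chains. *)

(** * Binary coordinates on the alphabet *)

(* [chi 1], [chi 2], [chi 3] are the three nonzero functionals on A = F_2^2,
   where v < 4 stands for its pair of binary digits. *)
Definition chi (p v : nat) : bool := odd p && odd v (+) (1 < p) && (1 < v).

Definition of_bits (b1 b2 : bool) : 'I_4 := inord (b1 + b2.*2).

Definition xor4 (v w : 'I_4) : 'I_4 :=
  of_bits (chi 1 v (+) chi 1 w) (chi 2 v (+) chi 2 w).

Lemma chiE p v : chi p v = (odd p && chi 1 v) (+) ((1 < p) && chi 2 v).
Proof. by rewrite /chi; case: (odd p); case: (odd v); case: (1 < p); case: (1 < v). Qed.

Lemma of_bitsK1 b1 b2 : chi 1 (of_bits b1 b2) = b1.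
Proof. by rewrite /of_bits inordK; case: b1; case: b2. Qed.

Lemma of_bitsK2 b1 b2 : chi 2 (of_bits b1 b2) = b2.
Proof. by rewrite /of_bits inordK; case: b1; case: b2. Qed.

Lemma chi_inj12 (v w : 'I_4) : chi 1 v = chi 1 w -> chi 2 v = chi 2 w -> v = w.
Proof.
case: v => [[|[|[|[|//]]]] hv]; case: w => [[|[|[|[|//]]]] hw] //= _ _;
  exact: val_inj.
Qed.

Lemma chi_xor4 p (v w : 'I_4) : chi p (xor4 v w) = chi p v (+) chi p w.
Proof.
rewrite chiE (chiE p v) (chiE p w) of_bitsK1 of_bitsK2.
by case: (odd p); case: (1 < p); case: (chi 1 v); case: (chi 2 v);
  case: (chi 1 w); case: (chi 2 w).
Qed.

Lemma chi0 p : chi p (ord0 : 'I_4) = false.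
Proof. by rewrite /chi /= !andbF. Qed.

Lemma xor4K (v w : 'I_4) : xor4 (xor4 v w) w = v.
Proof. by apply: chi_inj12; rewrite !chi_xor4 addbK. Qed.

Lemma xor4_inj w : injective (xor4^~ w).
Proof. by apply: (@can_inj _ _ _ (xor4^~ w)) => v; apply: xor4K. Qed.

Lemma xor4vv (v : 'I_4) : xor4 v v = ord0.
Proof. by apply: chi_inj12; rewrite chi_xor4 addbb chi0. Qed.

Lemma xor4_fix (v w : 'I_4) : xor4 v w = w -> v = ord0.
Proof. by move=> e; rewrite -[v](xor4K v w) e xor4vv. Qed.

(** Two distinct nonzero functionals form a basis of the dual of F_2^2, so together they separate
    points. *)
Lemma eq_of_two_chi p r (v w : 'I_4) : 0 < p < 4 -> 0 < r < 4 -> p != r ->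
  chi p v = chi p w -> chi r v = chi r w -> v = w.
Proof.
case: p => [|[|[|[|//]]]] // _; case: r => [|[|[|[|//]]]] // _ _;
case: v => [[|[|[|[|//]]]] hv]; case: w => [[|[|[|[|//]]]] hw] //= _ _;
exact: val_inj.
Qed.

(** Both fibres of a nonzero functional have two elements, so [u] and [v] exhaust theirs. Most
    contradictions below come from a third value in such a class. *)
Lemma chi_class p (u v w : 'I_4) : 0 < p < 4 -> u != v ->
  chi p u = chi p v -> w != u -> w != v -> chi p w = ~~ chi p u.
Proof.
case: p => [|[|[|[|//]]]] // _;
case: u => [[|[|[|[|//]]]] hu]; case: v => [[|[|[|[|//]]]] hv] //= _ _;
case: w => [[|[|[|[|//]]]] hw] //=.
Qed.

Lemma chi_mate p (v : 'I_4) : 0 < p < 4 ->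
  exists2 w : 'I_4, w != v & chi p w = chi p v.
Proof.
case: p => [|[|[|[|//]]]] // _; case: v => [[|[|[|[|//]]]] hu];
 (* The mate of [v] is [v] plus the nonzero kernel element of [chi p], which is 2, 1, 3 for [p]
    equal to 1, 2, 3. *)
 [ exists (inord 2) | exists (inord 3) | exists (inord 0) | exists (inord 1)
 | exists (inord 1) | exists (inord 0) | exists (inord 3) | exists (inord 2)
 | exists (inord 3) | exists (inord 2) | exists (inord 1) | exists (inord 0)];
 by rewrite -?val_eqE /= ?inordK.
Qed.

(** * Latin squares and Latin cubes of order 4 *)

Definition latin2 (u : 'I_4 -> 'I_4 -> 'I_4) :=
  (forall a, injective (u a)) /\ (forall b, injective (u^~ b)).

Definition latin3 (g : 'I_4 -> 'I_4 -> 'I_4 -> 'I_4) :=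
  [/\ forall a b, injective (g a b),
      forall a c, injective (fun b => g a b c) &
      forall b c, injective (fun a => g a b c)].

(* All sequences of length k over {0,1,2,3} each of whose prefixes may be
   followed by its successor according to [ok]. *)
Fixpoint sols (ok : seq nat -> nat -> bool) k : seq (seq nat) :=
  if k is k'.+1 then
    flatten [seq [seq rcons s v | v <- iota 0 4 & ok s v] | s <- sols ok k']
  else [:: [::]].

(** Completeness of the enumeration: what is checked on every member of [sols] holds for every
    admissible table. *)
Lemma sols_complete ok F N :
  (forall k, k < N -> (F k < 4) && ok (mkseq F k) (F k)) ->
  mkseq F N \in sols ok N.
Proof.
elim: N => [|N IH] hF //.
have /andP[F4 okF] := hF N (ltnSn N).
apply/flatten_mapP; exists (mkseq F N).
  by apply: IH => k hk; apply: hF; apply: ltnW.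
rewrite mkseqS; apply/mapP; exists (F N) => //.
by rewrite mem_filter okF mem_iota.
Qed.

(* Squares and cubes are read in lexicographic order, and those of [squares]
   and [cubes] are normalized: they are the identity on the axes. *)
Definition ok2 (s : seq nat) v :=
  let k := size s in let x := k %/ 4 in let y := k %% 4 in
  [&& (x == 0) ==> (v == y), (y == 0) ==> (v == x),
      all (fun i => nth 0 s (x * 4 + i) != v) (iota 0 y) &
      all (fun i => nth 0 s (i * 4 + y) != v) (iota 0 x)].

Definition ok3 (s : seq nat) v :=
  let k := size s in
  let x := k %/ 16 in let y := k %/ 4 %% 4 in let z := k %% 4 in
  [&& (x == 0) && (y == 0) ==> (v == z), (x == 0) && (z == 0) ==> (v == y),
      (y == 0) && (z == 0) ==> (v == x),
      all (fun i => nth 0 s (x * 16 + y * 4 + i) != v) (iota 0 z),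
      all (fun i => nth 0 s (x * 16 + i * 4 + z) != v) (iota 0 y) &
      all (fun i => nth 0 s (i * 16 + y * 4 + z) != v) (iota 0 x)].

Definition squares := sols ok2 16.
Definition cubes := sols ok3 64.

Definition at2 (s : seq nat) x y := nth 0 s (x * 4 + y).
Definition at3 (s : seq nat) x y z := nth 0 s (x * 16 + y * 4 + z).

Definition tab2 (h : 'I_4 -> 'I_4 -> 'I_4) : seq nat :=
  mkseq (fun k => h (inord (k %/ 4)) (inord (k %% 4)) : nat) 16.

Definition tab3 (h : 'I_4 -> 'I_4 -> 'I_4 -> 'I_4) : seq nat :=
  mkseq
    (fun k => h (inord (k %/ 16)) (inord (k %/ 4 %% 4)) (inord (k %% 4)) : nat) 64.

Lemma at2_tab2 h (a b : 'I_4) : at2 (tab2 h) a b = h a b.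
Proof.
have ha := ltn_ord a; have hb := ltn_ord b.
rewrite /at2 nth_mkseq; last lia.
have -> : (a * 4 + b) %/ 4 = a by lia.
have -> : (a * 4 + b) %% 4 = b by lia.
by rewrite !inord_val.
Qed.

Lemma at3_tab3 h (a b c : 'I_4) : at3 (tab3 h) a b c = h a b c.
Proof.
have ha := ltn_ord a; have hb := ltn_ord b; have hc := ltn_ord c.
rewrite /at3 nth_mkseq; last lia.
have -> : (a * 16 + b * 4 + c) %/ 16 = a by lia.
have -> : (a * 16 + b * 4 + c) %/ 4 %% 4 = b by lia.
have -> : (a * 16 + b * 4 + c) %% 4 = c by lia.
by rewrite !inord_val.
Qed.

Lemma inord_lt_neq (i j : nat) : i < j -> j < 4 -> inord i <> inord j :> 'I_4.
Proof. by move=> hij hj /(congr1 (@nat_of_ord _)); rewrite !inordK; lia. Qed.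

Lemma tab2_squares h : latin2 h -> (forall a, h a ord0 = a) ->
  (forall b, h ord0 b = b) -> tab2 h \in squares.
Proof.
move=> [hr hc] h1 h2; apply: sols_complete => k hk; rewrite ltn_ord /=.
rewrite /ok2 size_mkseq.
set x := k %/ 4; set y := k %% 4.
have hx : x < 4 by rewrite /x; lia.
have hy : y < 4 by rewrite /y; lia.
have kE : k = x * 4 + y by rewrite /x /y; lia.
have i0 : inord 0 = ord0 :> 'I_4 by apply: val_inj; rewrite /= inordK.
apply/and4P; split.
- by apply/implyP => /eqP ->; rewrite i0 h2 inordK.
- by apply/implyP => /eqP ->; rewrite i0 h1 inordK.
- apply/allP => i; rewrite mem_iota add0n => /= hi.
  rewrite nth_mkseq; last lia.
  have -> : (x * 4 + i) %/ 4 = x by lia.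
  have -> : (x * 4 + i) %% 4 = i by lia.
  apply/eqP => /val_inj/hr; exact: inord_lt_neq.
- apply/allP => i; rewrite mem_iota add0n => /= hi.
  rewrite nth_mkseq; last lia.
  have -> : (i * 4 + y) %/ 4 = i by lia.
  have -> : (i * 4 + y) %% 4 = y by lia.
  apply/eqP => /val_inj/hc; exact: inord_lt_neq.
Qed.

Lemma tab3_cubes h : latin3 h -> (forall a, h a ord0 ord0 = a) ->
  (forall b, h ord0 b ord0 = b) -> (forall c, h ord0 ord0 c = c) ->
  tab3 h \in cubes.
Proof.
move=> [hl3 hl2 hl1] h1 h2 h3; apply: sols_complete => k hk; rewrite ltn_ord /=.
rewrite /ok3 size_mkseq.
set x := k %/ 16; set y := k %/ 4 %% 4; set z := k %% 4.
have hx : x < 4 by rewrite /x; lia.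
have hy : y < 4 by rewrite /y; lia.
have hz : z < 4 by rewrite /z; lia.
have kE : k = x * 16 + y * 4 + z by rewrite /x /y /z; lia.
have i0 : inord 0 = ord0 :> 'I_4 by apply: val_inj; rewrite /= inordK.
apply/and5P; split; last (apply/andP; split).
- by apply/implyP => /andP[/eqP -> /eqP ->]; rewrite i0 h3 inordK.
- by apply/implyP => /andP[/eqP -> /eqP ->]; rewrite i0 h2 inordK.
- by apply/implyP => /andP[/eqP -> /eqP ->]; rewrite i0 h1 inordK.
- apply/allP => i; rewrite mem_iota add0n => /= hi.
  rewrite nth_mkseq; last lia.
  have -> : (x * 16 + y * 4 + i) %/ 16 = x by lia.
  have -> : (x * 16 + y * 4 + i) %/ 4 %% 4 = y by lia.
  have -> : (x * 16 + y * 4 + i) %% 4 = i by lia.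
  apply/eqP => /val_inj/hl3; exact: inord_lt_neq.
- apply/allP => i; rewrite mem_iota add0n => /= hi.
  rewrite nth_mkseq; last lia.
  have -> : (x * 16 + i * 4 + z) %/ 16 = x by lia.
  have -> : (x * 16 + i * 4 + z) %/ 4 %% 4 = i by lia.
  have -> : (x * 16 + i * 4 + z) %% 4 = z by lia.
  apply/eqP => /val_inj/hl2; exact: inord_lt_neq.
- apply/allP => i; rewrite mem_iota add0n => /= hi.
  rewrite nth_mkseq; last lia.
  have -> : (i * 16 + y * 4 + z) %/ 16 = i by lia.
  have -> : (i * 16 + y * 4 + z) %/ 4 %% 4 = y by lia.
  have -> : (i * 16 + y * 4 + z) %% 4 = z by lia.
  apply/eqP => /val_inj/hl1; exact: inord_lt_neq.
Qed.

(** * Normalization of Latin squares and cubes *)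

Section Normalization.

Variables (s1 s2 s3 : 'I_4 -> 'I_4) (c : 'I_4).
Hypotheses (inj1 : injective s1) (inj2 : injective s2) (inj3 : injective s3).

(** Renaming the coordinates by [s1] and [s2] and translating the values by [c] turns both axes into
    the identity. This change of variables depends on the axes alone, so squares with common axes
    are normalized simultaneously. *)
Lemma normalize2 u : latin2 u -> u ord0 ord0 = c ->
  (forall a, u a ord0 = xor4 (s1 a) c) -> (forall b, u ord0 b = xor4 (s2 b) c) ->
  exists2 h, tab2 h \in squares & forall a b, u a b = xor4 (h (s1 a) (s2 b)) c.
Proof.
move=> [hr hc] u0 h1 h2.
have z1 : invF inj1 ord0 = ord0.
  by rewrite -[RHS](invF_f inj1) (_ : s1 ord0 = ord0) //; apply: (@xor4_fix _ c); rewrite -h1.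
have z2 : invF inj2 ord0 = ord0.
  by rewrite -[RHS](invF_f inj2) (_ : s2 ord0 = ord0) //; apply: (@xor4_fix _ c); rewrite -h2.
exists (fun X Y => xor4 (u (invF inj1 X) (invF inj2 Y)) c); last first.
  by move=> a b; rewrite !invF_f xor4K.
apply: tab2_squares.
- split=> [a b b' /xor4_inj/hr|b a a' /xor4_inj/hc].
    exact: (can_inj (f_invF inj2)).
  exact: (can_inj (f_invF inj1)).
- by move=> a; rewrite z2 h1 f_invF xor4K.
- by move=> a; rewrite z1 h2 f_invF xor4K.
Qed.

Lemma normalize3 g : latin3 g -> g ord0 ord0 ord0 = c ->
  (forall x, g x ord0 ord0 = xor4 (s1 x) c) ->
  (forall y, g ord0 y ord0 = xor4 (s2 y) c) ->
  (forall z, g ord0 ord0 z = xor4 (s3 z) c) ->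
  exists2 h, tab3 h \in cubes &
    forall x y z, g x y z = xor4 (h (s1 x) (s2 y) (s3 z)) c.
Proof.
move=> [hl3 hl2 hl1] g0 h1 h2 h3.
have z1 : invF inj1 ord0 = ord0.
  by rewrite -[RHS](invF_f inj1) (_ : s1 ord0 = ord0) //; apply: (@xor4_fix _ c); rewrite -h1.
have z2 : invF inj2 ord0 = ord0.
  by rewrite -[RHS](invF_f inj2) (_ : s2 ord0 = ord0) //; apply: (@xor4_fix _ c); rewrite -h2.
have z3 : invF inj3 ord0 = ord0.
  by rewrite -[RHS](invF_f inj3) (_ : s3 ord0 = ord0) //; apply: (@xor4_fix _ c); rewrite -h3.
exists (fun X Y Z => xor4 (g (invF inj1 X) (invF inj2 Y) (invF inj3 Z)) c); last first.
  by move=> x y z; rewrite !invF_f xor4K.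
apply: tab3_cubes.
- split=> [x y z z' /xor4_inj/hl3|x z y y' /xor4_inj/hl2|y z x x' /xor4_inj/hl1].
  + exact: (can_inj (f_invF inj3)).
  + exact: (can_inj (f_invF inj2)).
  + exact: (can_inj (f_invF inj1)).
- by move=> x; rewrite z2 z3 h1 f_invF xor4K.
- by move=> y; rewrite z1 z3 h2 f_invF xor4K.
- by move=> z; rewrite z1 z2 h3 f_invF xor4K.
Qed.

End Normalization.

(** * Finite checks on normalized squares and cubes *)

Definition sep2 (s : seq nat) p :=
  all (fun x => all (fun y => chi p (at2 s x y) == chi p x (+) chi p y)
    (iota 0 4)) (iota 0 4).

Definition sep3 (s : seq nat) p :=
  all (fun x => all (fun y => all (fun z =>
    chi p (at3 s x y z) == chi p x (+) chi p y (+) chi p z)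
    (iota 0 4)) (iota 0 4)) (iota 0 4).

Definition agree3 s t :=
  all (fun x => all (fun y => all (fun z =>
    [|| x == 0, y == 0 | z == 0] ==> (at3 s x y z == at3 t x y z))
    (iota 0 4)) (iota 0 4)) (iota 0 4).

(** The normalized squares are the Klein group table and three tables of the cyclic group; each
    group has a homomorphism onto Z/2, which is some [chi p]. *)
Lemma squares_sep : all (fun s => has (sep2 s) (iota 1 3)) squares.
Proof. by vm_compute. Qed.

(** This is the three-dimensional case of the semilinearity of two different extensions: a cube that
    is not semilinear is the only one with its coordinate planes. *)
Lemma cubes_sep : all (fun s => has (sep3 s) (iota 1 3) ||
  all (fun t => agree3 s t ==> (s == t)) cubes) cubes.
Proof. by vm_compute. Qed.

(** Call a line full if the two squares differ on it everywhere off coordinate 0. For squares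
    semilinear for different functionals, a full line forces a full perpendicular line through any
    point [a] at which both leave the class of the value at 0. *)
Lemma squares_cross : all (fun s => all (fun t => all (fun p => all (fun p' =>
  [&& p != p', sep2 s p & sep2 t p'] ==>
  all (fun b => all (fun x => at2 s x b != at2 t x b) (iota 1 3) ==>
    all (fun a =>
      (chi p (at2 s a b) != chi p (at2 s 0 b)) &&
      (chi p' (at2 t a b) != chi p' (at2 t 0 b)) ==>
      (chi p (at2 s a b) != chi p (at2 s a 0)) &&
      all (fun y => at2 s a y != at2 t a y) (iota 1 3))
    (iota 1 3)) (iota 1 3))
  (iota 1 3)) (iota 1 3)) squares) squares.
Proof. by vm_compute. Qed.

Definition swapped (a b u v : nat) := (u == a) && (v == b) || (u == b) && (v == a).

(** If no line off the axes is full, then an unordered pair of different values shared by three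
    corners of a rectangle off the axes is shared by the fourth. *)
Lemma squares_swap : all (fun s => all (fun t =>
  all (fun b => has (fun x => at2 s x b == at2 t x b) (iota 1 3)) (iota 1 3) &&
  all (fun a => has (fun y => at2 s a y == at2 t a y) (iota 1 3)) (iota 1 3) ==>
  all (fun x => all (fun x' => (x != x') ==>
  all (fun y => all (fun y' => (y != y') ==>
    let a := at2 s x y in let b := at2 t x y in
    (a != b) ==> swapped a b (at2 s x' y) (at2 t x' y) ==>
    swapped a b (at2 s x y') (at2 t x y') ==>
    swapped a b (at2 s x' y') (at2 t x' y'))
  (iota 1 3)) (iota 1 3)) (iota 1 3)) (iota 1 3)) squares) squares.
Proof. by vm_compute. Qed.

Lemma ord4_iota (v : 'I_4) : (v : nat) \in iota 0 4.
Proof. by rewrite mem_iota ltn_ord. Qed.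

Lemma ord4_iota_gt0 (v : 'I_4) : v != ord0 -> (v : nat) \in iota 1 3.
Proof. by rewrite mem_iota ltn_ord -val_eqE /=; lia. Qed.

Lemma axis_inj (f : 'I_4 -> 'I_4) c : injective f -> injective (fun x => xor4 (f x) c).
Proof. by move=> fI x y /xor4_inj/fI. Qed.

Lemma latin2_sep u : latin2 u -> exists2 p, 0 < p < 4 &
  forall a b, chi p (u a b) =
    chi p (u a ord0) (+) chi p (u ord0 b) (+) chi p (u ord0 ord0).
Proof.
move=> lu; have [hr hc] := lu.
set c := u ord0 ord0.
have [| |h hs uE] :=
  normalize2 (@axis_inj _ c (hc ord0)) (@axis_inj _ c (hr ord0)) lu erefl _ _.
- by move=> a; rewrite xor4K.
- by move=> b; rewrite xor4K.
have /hasP[p] := allP squares_sep _ hs.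
rewrite mem_iota => hp /allP sp.
have {}sp x y : chi p (h x y) = chi p x (+) chi p y.
  by have /allP/(_ _ (ord4_iota y))/eqP := sp _ (ord4_iota x); rewrite at2_tab2.
exists p; first lia.
move=> a b; rewrite uE chi_xor4 sp !chi_xor4 -/c.
by case: (chi p (u a ord0)); case: (chi p (u ord0 b)); case: (chi p c).
Qed.

Lemma latin3_sep g g' : latin3 g -> latin3 g' ->
  (forall x y z, [|| x == ord0, y == ord0 | z == ord0] -> g x y z = g' x y z) ->
  (exists x y z, g x y z != g' x y z) ->
  exists2 p, 0 < p < 4 & forall x y z, chi p (g x y z) =
    chi p (g x ord0 ord0) (+) chi p (g ord0 y ord0) (+) chi p (g ord0 ord0 z).
Proof.
move=> lg lg' agr [x0 [y0 [z0 dif]]]; have [hl3 hl2 hl1] := lg.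
set c := g ord0 ord0 ord0.
have [| | |h hs gE] := normalize3 (@axis_inj _ c (hl1 ord0 ord0))
  (@axis_inj _ c (hl2 ord0 ord0)) (@axis_inj _ c (hl3 ord0 ord0)) lg erefl _ _ _;
  [by move=> *; rewrite xor4K .. |].
have [| | |h' hs' gE'] := normalize3 (@axis_inj _ c (hl1 ord0 ord0))
  (@axis_inj _ c (hl2 ord0 ord0)) (@axis_inj _ c (hl3 ord0 ord0)) lg'
  (esym (agr ord0 ord0 ord0 isT)) _ _ _;
  [by move=> *; rewrite ?xor4K -agr // eqxx ?orbT .. |].
have /orP[/hasP[p]|/allP/(_ _ hs')/implyP eqh] := allP cubes_sep _ hs.
  rewrite mem_iota => hp /allP sp.
  have {}sp x y z : chi p (h x y z) = chi p x (+) chi p y (+) chi p z.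
    have /allP/(_ _ (ord4_iota y))/allP/(_ _ (ord4_iota z))/eqP := sp _ (ord4_iota x).
    by rewrite at3_tab3.
  exists p; first lia.
  move=> x y z; rewrite gE chi_xor4 sp !chi_xor4 -/c.
  by case: (chi p (g x _ _)); case: (chi p (g _ y _)); case: (chi p (g _ _ z));
    case: (chi p c).
have s1I := @axis_inj _ c (hl1 ord0 ord0).
have s2I := @axis_inj _ c (hl2 ord0 ord0).
have s3I := @axis_inj _ c (hl3 ord0 ord0).
(* In the remaining case the common normalization carries the agreement on the coordinate planes
   over to the tables, which are therefore equal, against [dif]. *)
have {}eqh : tab3 h = tab3 h'.
  have lt4 n : n \in iota 0 4 -> n < 4 by rewrite mem_iota.
  apply/eqP/eqh/allP => x /lt4 hx; apply/allP => y /lt4 hy.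
  apply/allP => z /lt4 hz; apply/implyP => h0.
  have [a aE] : exists a, xor4 (g a ord0 ord0) c = Ordinal hx.
    by exists (invF s1I (Ordinal hx)); rewrite -[RHS](f_invF s1I).
  have [b bE] : exists b, xor4 (g ord0 b ord0) c = Ordinal hy.
    by exists (invF s2I (Ordinal hy)); rewrite -[RHS](f_invF s2I).
  have [d dE] : exists d, xor4 (g ord0 ord0 d) c = Ordinal hz.
    by exists (invF s3I (Ordinal hz)); rewrite -[RHS](f_invF s3I).
  have := agr a b d; rewrite gE gE' aE bE dE.
  rewrite -[x]/(nat_of_ord (Ordinal hx)) -[y]/(nat_of_ord (Ordinal hy)).
  rewrite -[z]/(nat_of_ord (Ordinal hz)) !at3_tab3 => eg.
  suff /eg/xor4_inj-> : [|| a == ord0, b == ord0 | d == ord0] by [].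
  case/or3P: h0 => h0; apply/or3P.
  - apply: Or31; apply/eqP/s1I; rewrite aE xor4vv; exact/val_inj/eqP.
  - apply: Or32; apply/eqP/s2I; rewrite bE xor4vv; exact/val_inj/eqP.
  - apply: Or33; apply/eqP/s3I; rewrite dE xor4vv; exact/val_inj/eqP.
case/negP: dif; apply/eqP; rewrite gE gE'; congr xor4.
by apply: val_inj; rewrite /= -!at3_tab3 eqh.
Qed.

(** * Two Latin squares with common axes *)

Section SquarePair.

Variables u u' : 'I_4 -> 'I_4 -> 'I_4.
Hypotheses (lu : latin2 u) (lu' : latin2 u').
Hypotheses (ag1 : forall a, u a ord0 = u' a ord0).
Hypotheses (ag2 : forall b, u ord0 b = u' ord0 b).

Lemma normalize_pair : exists h h' s1 s2 c,
  [/\ tab2 h \in squares /\ tab2 h' \in squares,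
      injective s1 /\ injective s2,
      u ord0 ord0 = c /\
        (forall a, u a ord0 = xor4 (s1 a) c) /\ (forall b, u ord0 b = xor4 (s2 b) c),
      forall a b, u a b = xor4 (h (s1 a) (s2 b)) c &
      forall a b, u' a b = xor4 (h' (s1 a) (s2 b)) c].
Proof.
have [hr hc] := lu; set c := u ord0 ord0.
have [| |h hs uE] :=
  normalize2 (@axis_inj _ c (hc ord0)) (@axis_inj _ c (hr ord0)) lu erefl _ _;
  [by move=> *; rewrite xor4K .. |].
have [| |h' hs' uE'] :=
  normalize2 (@axis_inj _ c (hc ord0)) (@axis_inj _ c (hr ord0)) lu'
    (esym (ag1 ord0)) _ _; [by move=> *; rewrite xor4K -?ag1 -?ag2 .. |].
exists h, h', (fun x => xor4 (u x ord0) c), (fun y => xor4 (u ord0 y) c), c.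
split=> //.
- by split; apply: axis_inj.
- by split=> //; split=> *; rewrite xor4K.
Qed.

Lemma latin2_cross p p' (b a : 'I_4) : 0 < p < 4 -> 0 < p' < 4 -> p != p' ->
  (forall x y, chi p (u x y) =
    chi p (u x ord0) (+) chi p (u ord0 y) (+) chi p (u ord0 ord0)) ->
  (forall x y, chi p' (u' x y) =
    chi p' (u' x ord0) (+) chi p' (u' ord0 y) (+) chi p' (u' ord0 ord0)) ->
  b != ord0 -> (forall x, x != ord0 -> u x b != u' x b) ->
  chi p (u a b) != chi p (u ord0 b) -> chi p' (u' a b) != chi p' (u' ord0 b) ->
  chi p (u a b) != chi p (u a ord0) /\
  (forall y, y != ord0 -> u a y != u' a y).
Proof.
have [h [h' [s1 [s2 [c [[hs hs'] [i1 i2] [uc [u1 u2]] uE uE']]]]]] := normalize_pair.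
move=> hp hp' npp sp sp' b0 dif ca ca'.
have z1 : s1 ord0 = ord0 by apply: (@xor4_fix _ c); rewrite -u1.
have z2 : s2 ord0 = ord0 by apply: (@xor4_fix _ c); rewrite -u2.
have nz1 x : x != ord0 -> s1 x != ord0 by rewrite -{2}z1 (inj_eq i1).
have nz2 x : x != ord0 -> s2 x != ord0 by rewrite -{2}z2 (inj_eq i2).
have sur1 (X : 'I_4) : exists x, s1 x = X.
  by exists (invF i1 X); rewrite f_invF.
have sur2 (X : 'I_4) : exists x, s2 x = X.
  by exists (invF i2 X); rewrite f_invF.
have a0 : a != ord0 by apply: contraNneq ca => ->.
have p3 : p \in iota 1 3 by rewrite mem_iota.
have p3' : p' \in iota 1 3 by rewrite mem_iota.
(* Semilinearity passes to the normalized table; [v] and [k] are generic so that this serves both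
   squares. *)
have sep r (v k : 'I_4 -> 'I_4 -> 'I_4) :
    (forall x y, v x y = xor4 (k (s1 x) (s2 y)) c) ->
    (forall x, v x ord0 = u x ord0) -> (forall y, v ord0 y = u ord0 y) ->
    (forall x y, chi r (v x y) =
      chi r (v x ord0) (+) chi r (v ord0 y) (+) chi r (v ord0 ord0)) ->
    sep2 (tab2 k) r.
  move=> vE v1 v2 sv; apply/allP => X; rewrite mem_iota => hX.
  apply/allP => Y; rewrite mem_iota => hY; apply/eqP.
  have [x ex] := sur1 (Ordinal hX); have [y ey] := sur2 (Ordinal hY).
  rewrite -[X]/(nat_of_ord (Ordinal hX)) -[Y]/(nat_of_ord (Ordinal hY)).
  rewrite at2_tab2 -ex -ey; have := sv x y.
  rewrite vE v1 v2 v1 uc u1 u2 !chi_xor4.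
  by case: (chi r (k _ _)); case: (chi r (s1 x)); case: (chi r (s2 y)); case: (chi r c).
have sh := sep _ _ _ uE (fun=> erefl) (fun=> erefl) sp.
have sh' := sep _ _ _ uE' (fun x => esym (ag1 x)) (fun y => esym (ag2 y)) sp'.
have := allP squares_cross _ hs => /allP/(_ _ hs')/allP/(_ _ p3)/allP/(_ _ p3').
rewrite npp sh sh' implyTb => /allP/(_ _ (ord4_iota_gt0 (nz2 _ b0)))/implyP H.
have /H/allP/(_ _ (ord4_iota_gt0 (nz1 _ a0)))/implyP {}H :
    all (fun x => at2 (tab2 h) x (s2 b) != at2 (tab2 h') x (s2 b)) (iota 1 3).
  apply/allP => X; rewrite mem_iota => hX; have /andP[_ X4] := hX.
  have [x ex] := sur1 (Ordinal X4).
  have x0 : x != ord0.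
    by apply: contraTneq hX => x0; rewrite -[X]/(nat_of_ord (Ordinal X4)) -ex x0 z1.
  rewrite -[X]/(nat_of_ord (Ordinal X4)) -ex !at2_tab2 val_eqE.
  by apply: contraNneq (dif x x0) => e; rewrite uE uE' e.
have v0 v x : at2 (tab2 v) 0 (s2 x) = v (s1 ord0) (s2 x) by rewrite z1 -at2_tab2.
have v1 v x : at2 (tab2 v) (s1 x) 0 = v (s1 x) (s2 ord0) by rewrite z2 -at2_tab2.
have cE r v k x y x' y' : (forall x y, v x y = xor4 (k (s1 x) (s2 y)) c) ->
    (chi r (k (s1 x) (s2 y)) != chi r (k (s1 x') (s2 y'))) =
    (chi r (v x y) != chi r (v x' y')).
  move=> vE; rewrite !vE !chi_xor4.
  by case: (chi r (k (s1 x) _)); case: (chi r (k (s1 x') _)); case: (chi r c).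
rewrite !v0 !v1 !at2_tab2 !(cE _ _ _ _ _ _ _ uE) !(cE _ _ _ _ _ _ _ uE') ca ca' in H.
have /andP[-> /allP h3] := H isT; split=> // y /nz2/ord4_iota_gt0/h3.
by rewrite !at2_tab2 val_eqE uE uE'; apply: contraNneq => /xor4_inj ->.
Qed.

Lemma latin2_swap (x x' y y' : 'I_4) :
  (forall b, b != ord0 -> exists2 x, x != ord0 & u x b = u' x b) ->
  (forall a, a != ord0 -> exists2 y, y != ord0 & u a y = u' a y) ->
  x != ord0 -> x' != ord0 -> y != ord0 -> y' != ord0 -> x != x' -> y != y' ->
  u x y != u' x y ->
  swapped (u x y) (u' x y) (u x' y) (u' x' y) ->
  swapped (u x y) (u' x y) (u x y') (u' x y') ->
  swapped (u x y) (u' x y) (u x' y') (u' x' y').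
Proof.
have [h [h' [s1 [s2 [c [[hs hs'] [i1 i2] [uc [u1 u2]] uE uE']]]]]] := normalize_pair.
have z1 : s1 ord0 = ord0 by apply: (@xor4_fix _ c); rewrite -u1.
have z2 : s2 ord0 = ord0 by apply: (@xor4_fix _ c); rewrite -u2.
have nz1 t : t != ord0 -> s1 t != ord0 by rewrite -{2}z1 (inj_eq i1).
have nz2 t : t != ord0 -> s2 t != ord0 by rewrite -{2}z2 (inj_eq i2).
have sw (k1 k2 k3 k4 : 'I_4) :
    swapped (xor4 k1 c) (xor4 k2 c) (xor4 k3 c) (xor4 k4 c) = swapped k1 k2 k3 k4.
  by rewrite /swapped !val_eqE !(inj_eq (@xor4_inj c)).
move=> nl1 nl2 x0 x0' y0 y0' xx yy; rewrite !uE !uE' !sw (inj_eq (@xor4_inj c)).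
have := allP squares_swap _ hs => /allP/(_ _ hs')/implyP.
move=> /(_ _)/allP/(_ _ (ord4_iota_gt0 (nz1 _ x0)))/allP/(_ _ (ord4_iota_gt0 (nz1 _ x0'))).
rewrite !val_eqE (inj_eq i1) xx implyTb => H.
have lt4 n : n \in iota 1 3 -> n < 4 by rewrite mem_iota => /andP[].
have /H/allP/(_ _ (ord4_iota_gt0 (nz2 _ y0)))/allP/(_ _ (ord4_iota_gt0 (nz2 _ y0'))) :
  all (fun b => has (fun x => at2 (tab2 h) x b == at2 (tab2 h') x b) (iota 1 3)) (iota 1 3) &&
  all (fun a => has (fun y => at2 (tab2 h) a y == at2 (tab2 h') a y) (iota 1 3)) (iota 1 3).
  apply/andP; split.
    apply/allP => B hB; have B0 := hB; rewrite mem_iota in B0.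
    have [bb ebb] : exists bb, s2 bb = Ordinal (lt4 _ hB).
      by exists (invF i2 (Ordinal (lt4 _ hB))); rewrite f_invF.
    have /nl1[t t0 et] : bb != ord0.
      by apply: contraTneq B0 => b0; rewrite -[B]/(nat_of_ord (Ordinal (lt4 _ hB))) -ebb b0 z2.
    apply/hasP; exists (nat_of_ord (s1 t)); first exact/ord4_iota_gt0/nz1.
    rewrite -[B]/(nat_of_ord (Ordinal (lt4 _ hB))) -ebb !at2_tab2.
    by move: et; rewrite uE uE' => /xor4_inj ->.
  apply/allP => A hA; have A0 := hA; rewrite mem_iota in A0.
  have [aa eaa] : exists aa, s1 aa = Ordinal (lt4 _ hA).
    by exists (invF i1 (Ordinal (lt4 _ hA))); rewrite f_invF.
  have /nl2[t t0 et] : aa != ord0.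
    by apply: contraTneq A0 => b0; rewrite -[A]/(nat_of_ord (Ordinal (lt4 _ hA))) -eaa b0 z1.
  apply/hasP; exists (nat_of_ord (s2 t)); first exact/ord4_iota_gt0/nz2.
  rewrite -[A]/(nat_of_ord (Ordinal (lt4 _ hA))) -eaa !at2_tab2.
  by move: et; rewrite uE uE' => /xor4_inj ->.
by rewrite !at2_tab2 !val_eqE (inj_eq i2) yy implyTb => /implyP I /I /implyP J /J /implyP.
Qed.

End SquarePair.

(** * Lines *)

Section Lines.

Variables v v' : 'I_4 -> 'I_4.
Hypotheses (vI : injective v) (vI' : injective v').

Lemma line_onto w : exists a, v a = w.
Proof. by exists (invF vI w); rewrite f_invF. Qed.

Lemma line_mate p d : 0 < p < 4 -> exists e, [/\ e != d, chi p (v e) = chi p (v d) &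
  forall b, b != d -> b != e -> chi p (v b) = ~~ chi p (v d)].
Proof.
move=> hp; have [w wd ew] := chi_mate (v d) hp; have [e ve] := line_onto w.
exists e; rewrite ve; split=> // [|b bd be].
  by apply: contraNneq wd => <-; rewrite ve.
by apply: (chi_class hp _ (esym ew)); rewrite -?ve ?(inj_eq vI) // eq_sym -(inj_eq vI) ve.
Qed.

Hypothesis v0 : v ord0 = v' ord0.

(** Both lines take the class of the value at [ord0] on the same two coordinates. They agree at one
    of these, [ord0], and hence at the other. *)
Lemma line_same_chi r : 0 < r < 4 -> (forall a, chi r (v a) = chi r (v' a)) ->
  exists2 a, a != ord0 & v a = v' a.
Proof.
move=> hr vv; have [a [a0 ea cls]] := line_mate ord0 hr.
exists a => //; apply/eqP; rewrite eq_sym; apply: contraT => ne.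
have : chi r (v' a) = ~~ chi r (v ord0).
  apply: (@chi_class r _ (v a)) => //.
- by rewrite (inj_eq vI) eq_sym.
- by rewrite v0 (inj_eq vI').
by rewrite -vv ea; case: chi.
Qed.

(** The lines agree at two of the four coordinates, so on the other two they agree or have their
    values interchanged. *)
Lemma line_swap d : v d != v' d -> (exists2 a, a != ord0 & v a = v' a) ->
  exists e, [/\ e != d, e != ord0, v e = v' d & v' e = v d].
Proof.
move=> dd [a a0 va]; have [e ve] := line_onto (v' d).
have d0 : d != ord0 by apply: contraNneq dd => ->; rewrite v0.
have ed : e != d by apply: contraNneq dd => ed; rewrite -{1}ed ve.
have e0 : e != ord0.
  by apply: contraNneq d0 => e0; rewrite -(inj_eq vI') -ve e0 v0.
exists e; split=> //.
have [f vf] : exists f, v' f = v d by exists (invF vI' (v d)); rewrite f_invF.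
have fd : f != d by apply: contraNneq dd => fd; rewrite -{2}fd vf.
have f0 : f != ord0.
  by apply: contraNneq d0 => f0; rewrite -(inj_eq vI) -vf f0 v0.
(* Otherwise [ord0], [a], [d], [e], [f] would be five different elements of ['I_4]. *)
have [->//|fe] := eqVneq e f.
have ad : a != d by apply: contraNneq dd => <-; rewrite va.
have ae : a != e by apply: contraNneq ed => ea; rewrite -(inj_eq vI') -ve -ea va.
have af : a != f by apply: contraNneq fd => fa; rewrite -(inj_eq vI) -vf -fa va.
move: a0 d0 e0 f0 ed fd fe ad ae af {va ve vf dd}; rewrite -!val_eqE /=.
move: (ltn_ord a) (ltn_ord d) (ltn_ord e) (ltn_ord f).
move: (nat_of_ord a) (nat_of_ord d) (nat_of_ord e) (nat_of_ord f).
clear; lia.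
Qed.

(** On each line the class of the value at [ord0] occupies [ord0] and one more coordinate, so at
    least one of the four coordinates avoids both classes. *)
Lemma line_common p p' : 0 < p < 4 -> 0 < p' < 4 -> exists a,
  chi p (v a) != chi p (v ord0) /\ chi p' (v' a) != chi p' (v' ord0).
Proof.
move=> hp hp'; have [b [b0 _ hb]] := line_mate ord0 hp.
have [w wd ew] := chi_mate (v' ord0) hp'.
pose b' := invF vI' w; have vb' : v' b' = w by rewrite f_invF.
have [a a0 /andP[ab ab']] : exists2 a, a != ord0 & (a != b) && (a != b').
  have : ~~ ([set: 'I_4] \subset [set ord0; b; b']).
    apply/negP => /subset_leq_card; rewrite cardsT card_ord leqNgt.
    by rewrite (leq_ltn_trans (leq_card_setU _ _)) // cards2 cards1; case: (_ != _).
  case/subsetPn => a _; rewrite !inE !negb_or => /andP[/andP[a0 ab] ab'].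
  by exists a; rewrite ?ab.
exists a; split; first by rewrite hb //; case: chi.
rewrite (@chi_class p' (v' ord0) w (v' a)) //; first by case: chi.
- by rewrite eq_sym.
- by rewrite (inj_eq vI').
- by rewrite -vb' (inj_eq vI').
Qed.

End Lines.

(** * Semilinear boxes *)

Section Boxes.

Variable n : nat.
Local Notation point := {ffun 'I_n -> 'I_4}.
Implicit Types (x y z : point) (T : {set 'I_n}) (q : point -> 'I_4).

Definition upd x (i : 'I_n) a : point := [ffun j => if j == i then a else x j].

Lemma upd_eq x i a : upd x i a i = a. Proof. by rewrite ffunE eqxx. Qed.

Lemma upd_neq x i a j : j != i -> upd x i a j = x j.
Proof. by move=> ji; rewrite ffunE (negbTE ji). Qed.

Lemma upd_id x i : upd x i (x i) = x.
Proof. by apply/ffunP => j; rewrite ffunE; case: eqP => // ->. Qed.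

Lemma updU x i a b : upd (upd x i a) i b = upd x i b.
Proof. by apply/ffunP => j; rewrite !ffunE; case: eqP. Qed.

Lemma updC x i j a b : i != j -> upd (upd x i a) j b = upd (upd x j b) i a.
Proof.
move=> ij; apply/ffunP => k; rewrite !ffunE; case: eqP => // ->.
by rewrite eq_sym (negbTE ij).
Qed.

Definition inbox T z x := forall i, i \notin T -> x i = z i.

Lemma inbox_upd T z x i a : i \in T -> inbox T z x -> inbox T z (upd x i a).
Proof. by move=> iT zx j jT; rewrite upd_neq ?zx //; apply: contraNneq jT => ->. Qed.

Lemma inboxxx T z : inbox T z z. Proof. by []. Qed.

Lemma inboxS T T' z z' x :
  T' \subset T -> inbox T z z' -> inbox T' z' x -> inbox T z x.
Proof.
by move=> /subsetP sT zz' xz' i iT; rewrite xz' ?zz' //; apply: contra iT => /sT.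
Qed.

Definition quasi q := forall x i, injective (fun a => q (upd x i a)).

(* [q] followed by [chi p] is a sum of functions of one coordinate each. *)
Definition SL p T z q := forall x i j a b, inbox T z x -> i \in T -> j \in T -> i != j ->
  chi p (q (upd (upd x i a) j b)) (+) chi p (q (upd x j b)) =
  chi p (q (upd x i a)) (+) chi p (q x).

(** The points with a free coordinate [ord0] are the sides of the box, so [q] and [q'] are two
    extensions of the same data, called siblings below. *)
Definition agree T z q q' :=
  forall x, inbox T z x -> (exists2 i, i \in T & x i = ord0) -> q x = q' x.

Lemma agree_sym T z q q' : agree T z q q' -> agree T z q' q.
Proof. by move=> ag x zx x0; rewrite ag. Qed.

Lemma agreeS T T' z z' q q' : T' \subset T -> inbox T z z' ->
  agree T z q q' -> agree T' z' q q'.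
Proof.
move=> sT zz' ag x xz' [i iT' xi]; apply: ag; first exact: inboxS xz'.
by exists i => //; apply: (subsetP sT).
Qed.

Lemma SLS p T T' z z' q : T' \subset T -> inbox T z z' -> SL p T z q -> SL p T' z' q.
Proof.
move=> sT zz' sl x i j a b xz' iT jT ij; apply: sl => //; rewrite ?(subsetP sT) //.
exact: inboxS xz'.
Qed.

(** The functional [s] is [p], [r] or their sum; the formula covers the three cases at once. *)
Lemma chi_third p r s (w : 'I_4) : 0 < p < 4 -> 0 < r < 4 -> 0 < s < 4 -> p != r ->
  chi s w = ((s != r) && chi p w) (+) ((s != p) && chi r w).
Proof.
case: p => [|[|[|[|//]]]] // _; case: r => [|[|[|[|//]]]] // _;
case: s => [|[|[|[|//]]]] // _ _; by case: w => [[|[|[|[|//]]]] hw].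
Qed.

Lemma SL_third p r s T z q : 0 < p < 4 -> 0 < r < 4 -> 0 < s < 4 -> p != r ->
  SL p T z q -> SL r T z q -> SL s T z q.
Proof.
move=> hp hr hs pr slp slr x i j a b zx iT jT ij.
have := slp x i j a b zx iT jT ij; have := slr x i j a b zx iT jT ij.
rewrite !(chi_third _ hp hr hs pr).
case: (s != r); case: (s != p); rewrite ?addFb ?addbF //= => h1 h2.
by rewrite addbACA h1 h2 addbACA.
Qed.

(** [SL] says that mixed second differences vanish: in a separated sum, the effect of changing
    coordinate [i] does not depend on the others. *)
Lemma sep_SL p T z q (F : 'I_n -> 'I_4 -> bool) c :
  (forall x, inbox T z x -> chi p (q x) = c (+) \big[addb/false]_(i in T) F i (x i)) ->
  SL p T z q.
Proof.
move=> qE x i j a b zx iT jT ij.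
have dE y : inbox T z y ->
    chi p (q (upd y i a)) (+) chi p (q y) = F i a (+) F i (y i).
  move=> zy; rewrite !qE //; last exact: inbox_upd.
  rewrite !(bigD1 i iT) /= upd_eq.
  rewrite (eq_bigr (fun k => F k (y k))); last first.
    by move=> k /andP[_ ki]; rewrite upd_neq.
  by case: (F i a); case: (F i (y i)); case: (\big[addb/false]_(_ | _) _); case: (c).
rewrite updC // !dE //; last exact: inbox_upd.
by rewrite upd_neq.
Qed.

(* Each coordinate that leaves the product of the pairs {m i, e i} complements [chi p],
   because a line with two points in a class has its other points in the other class. *)
Lemma box_SL p T z q (m : point) (e : 'I_n -> 'I_4) c : quasi q -> 0 < p < 4 ->
  inbox T z m -> (forall i, i \in T -> e i != m i) ->
  (forall y, inbox T z y -> (forall i, i \in T -> (y i == m i) || (y i == e i)) ->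
     chi p (q y) = c) ->
  SL p T z q.
Proof.
move=> qq hp zm em cst.
pose f i a := (a != m i) && (a != e i).
apply: (@sep_SL _ _ _ _ f c) => x.
move: {2}#|_| (erefl #|[set i in T | f i (x i)]|) => k.
elim: k x => [|k IH] x cx zx.
  have fF i : i \in T -> f i (x i) = false.
    by move=> iT; have /setP/(_ i) := cards0_eq cx; rewrite !inE iT.
  rewrite big1 ?addbF //; apply: cst => // i /fF.
  by rewrite /f; case: eqP => //; case: eqP.
have [i] : exists i, i \in [set i in T | f i (x i)] by apply/card_gt0P; rewrite cx.
rewrite inE => /andP[iT fi].
have flip a : ~~ f i a ->
    chi p (q (upd x i a)) = c (+) \big[addb/false]_(j in T | j != i) f j (x j).
  move=> fa; rewrite IH; last exact: inbox_upd.
    rewrite (bigD1 i iT) /= upd_eq (negbTE fa) /=; congr addb.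
    by apply: eq_bigr => j /andP[_ ji]; rewrite upd_neq.
  move: cx; rewrite (cardsD1 i) inE iT fi => -[<-]; apply: eq_card => j.
  by rewrite !inE ffunE; case: eqP => [->|]; rewrite ?(negbTE fa) ?andbF.
have fm : ~~ f i (m i) by rewrite /f eqxx.
have fe : ~~ f i (e i) by rewrite /f eqxx andbF.
rewrite (bigD1 i iT) /= fi /=.
rewrite -(upd_id x i) (@chi_class p (q (upd x i (m i))) (q (upd x i (e i)))) //.
- rewrite flip //; rewrite !upd_id.
  by case: (c); case: (\big[addb/false]_(_ | _) _).
- by rewrite (inj_eq (@qq x i)) eq_sym em.
- by rewrite !flip.
- by rewrite (inj_eq (@qq x i)); case/andP: fi.
- by rewrite (inj_eq (@qq x i)); case/andP: fi.
Qed.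

Lemma card_gt1_pair T : 1 < #|T| -> exists i j, [/\ i \in T, j \in T & i != j].
Proof. by case/card_gt1P => i [j [iT jT ij]]; exists i, j. Qed.

Lemma card_gt1_other T i : 1 < #|T| -> exists2 j, j \in T & j != i.
Proof.
move=> /card_gt1_pair[j [k [jT kT jk]]]; have [ji|ji] := eqVneq j i; last by exists j.
by exists k => //; rewrite -ji eq_sym.
Qed.

(** Setting two free coordinates to [ord0], separately and together, expresses [chi p (q x)] through
    three points on the sides. *)
Lemma SL_agree_chi p T z q q' : 1 < #|T| -> agree T z q q' ->
  SL p T z q -> SL p T z q' ->
  forall x, inbox T z x -> chi p (q x) = chi p (q' x).
Proof.
move=> /card_gt1_pair[i [j [iT jT ij]]] ag sl sl' x zx.
have := sl x i j ord0 ord0 zx iT jT ij; have := sl' x i j ord0 ord0 zx iT jT ij.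
have z0 y k : k \in T -> inbox T z y -> q (upd y k ord0) = q' (upd y k ord0).
  by move=> kT zy; apply: ag; [exact: inbox_upd|exists k; rewrite ?upd_eq].
rewrite !z0 //; last exact: inbox_upd.
by do 3![case: (chi p (q' (upd _ _ _)))]; case: (chi p (q x)); case: (chi p (q' x)).
Qed.

Lemma SL_agree_line p T z q q' x i : 1 < #|T| -> 0 < p < 4 -> quasi q -> quasi q' ->
  agree T z q q' -> SL p T z q -> SL p T z q' -> inbox T z x -> i \in T ->
  exists2 a, a != ord0 & q (upd x i a) = q' (upd x i a).
Proof.
move=> T2 hp qq qq' ag sl sl' zx iT.
apply: (line_same_chi (@qq x i) (@qq' x i) _ hp).
  by apply: ag; [exact: inbox_upd|exists i; rewrite ?upd_eq].
by move=> a; apply: (SL_agree_chi T2 ag sl sl'); apply: inbox_upd.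
Qed.

End Boxes.

Arguments inboxxx {n} T z.

(** * Semilinearity of siblings in dimensions 2 and 3, and in the absence of full lines *)

Section Siblings.

Variable n : nat.
Local Notation point := {ffun 'I_n -> 'I_4}.
Implicit Types (x y z : point) (T : {set 'I_n}) (q : point -> 'I_4).

Lemma SL_sep2 p T z q x i j : SL p T z q -> inbox T z x -> i \in T -> j \in T -> i != j ->
  let u a b := q (upd (upd x i a) j b) in
  forall a b, chi p (u a b) =
    chi p (u a ord0) (+) chi p (u ord0 b) (+) chi p (u ord0 ord0).
Proof.
move=> sl zx iT jT ij u a b.
have zx0 : inbox T z (upd (upd x i ord0) j ord0) by do 2?apply: inbox_upd.
have := sl _ i j a b zx0 iT jT ij.
rewrite updU [in upd (upd _ j _) i a]updC 1?eq_sym // updU updU.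
rewrite -/(u ord0 b) -/(u ord0 ord0) -/(u a ord0).
by rewrite /u; do 4![case: (chi p _)].
Qed.

Lemma latin2_plane q x i j : quasi q -> i != j ->
  latin2 (fun a b => q (upd (upd x i a) j b)).
Proof.
move=> qq ij; split=> [a b b' /qq //|b a a'].
by rewrite !(updC _ _ _ ij) => /qq.
Qed.

Lemma SL_square T z q : #|T| = 2 -> quasi q -> exists2 p, 0 < p < 4 & SL p T z q.
Proof.
move=> /eqP/cards2P[i [j [ij ->]]] qq.
have [p hp sp] := latin2_sep (latin2_plane z qq ij).
exists p => //.
pose u a b := q (upd (upd z i a) j b).
apply: (@sep_SL _ _ _ _ _ (fun k a => if k == i then chi p (u a ord0) else chi p (u ord0 a))
  (chi p (u ord0 ord0))) => x zx.
have xE : x = upd (upd z i (x i)) j (x j).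
  apply/ffunP => k; rewrite !ffunE; case: eqP => [->//|/eqP kj].
  by case: eqP => [->//|/eqP ki]; apply: zx; rewrite !inE negb_or ki.
rewrite {1}xE sp big_setU1 ?inE // big_set1 /= eqxx (eq_sym j) (negbTE ij).
by rewrite addbC addbA.
Qed.

Lemma SL_cube T z q q' d : #|T| = 3 -> quasi q -> quasi q' -> agree T z q q' ->
  inbox T z d -> q d != q' d -> exists2 p, 0 < p < 4 & SL p T z q.
Proof.
move=> T3 qq qq' ag zd dd.
have [i [j [k [[iT jT kT] [ij jk ki]]]]] : exists i j k,
  [/\ i \in T, j \in T & k \in T] /\ [/\ i != j, j != k & k != i].
  by apply/card_gt2P; rewrite T3.
have ik : i != k by rewrite eq_sym.
have TE : T = i |: [set j; k].
  apply/esym/eqP; rewrite eqEcard; apply/andP; split.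
    by apply/subsetP => l; rewrite !inE => /or3P[]/eqP->.
  by rewrite T3 cardsU1 cards2 !inE negb_or ij ik jk.
pose pt a b c := upd (upd (upd z i a) j b) k c.
have zpt a b c : inbox T z (pt a b c) by do 3?apply: inbox_upd.
have ptE x : inbox T z x -> x = pt (x i) (x j) (x k).
  move=> zx; apply/ffunP => l; rewrite !ffunE; case: eqP => [->//|/eqP lk].
  case: eqP => [->//|/eqP lj]; case: eqP => [->//|/eqP li].
  by apply: zx; rewrite TE !inE !negb_or li lj.
have lat r : quasi r -> latin3 (fun a b c => r (pt a b c)).
  move=> qr; split=> [a b c c' /qr //|a c b b'|b c a a']; rewrite /pt.
    by rewrite !(updC _ _ _ jk) => /qr.
  by rewrite !(updC _ _ _ ij) !(updC _ _ _ ik) => /qr.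
have [||p hp sp] := latin3_sep (lat _ qq) (lat _ qq').
- move=> a b c abc; apply: ag => //; case/or3P: abc => /eqP e.
  + by exists i; rewrite // !ffunE eqxx (negbTE ij) (negbTE ik).
  + by exists j; rewrite // !ffunE eqxx (negbTE jk).
  + by exists k; rewrite // !ffunE eqxx.
- by exists (d i), (d j), (d k); rewrite -ptE.
exists p => //.
apply: (@sep_SL _ _ _ _ _ (fun l a => if l == i then chi p (q (pt a ord0 ord0)) else
  if l == j then chi p (q (pt ord0 a ord0)) else chi p (q (pt ord0 ord0 a))) false) => x zx.
rewrite {1}(ptE x zx) sp TE big_setU1; last by rewrite !inE negb_or ij.
rewrite big_setU1 ?inE // big_set1 /= !eqxx.
by rewrite (eq_sym j) (negbTE ij) (negbTE ki) (eq_sym k) (negbTE jk) addbA.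
Qed.

(** Some nonzero functional vanishes on the sum of [v] and [w]. *)
Lemma chi_equal (v w : 'I_4) : exists2 p, 0 < p < 4 & chi p v = chi p w.
Proof.
have : has (fun p => chi p v == chi p w) [:: 1; 2; 3].
  case: v => [[|[|[|[|//]]]] hv]; by case: w => [[|[|[|[|//]]]] hw].
by case/hasP => p; rewrite !inE => /or3P[]/eqP-> /eqP e; [exists 1|exists 2|exists 3].
Qed.

Lemma swapped_trans a b u v : swapped a b u v -> swapped u v =2 swapped a b.
Proof.
case/orP => /andP[/eqP-> /eqP->] // c d.
by rewrite /swapped orbC.
Qed.

(** The last hypothesis excludes full lines. On a product of pairs {d i, e i} both siblings take
    only the two values they have at [d]; a functional that is constant on these two makes [box_SL]
    applicable. *)
Lemma SL_swap T z q q' d : quasi q -> quasi q' -> agree T z q q' ->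
  inbox T z d -> q d != q' d ->
  (forall x i, inbox T z x -> i \in T ->
     exists2 a, a != ord0 & q (upd x i a) = q' (upd x i a)) ->
  exists2 p, 0 < p < 4 & SL p T z q.
Proof.
move=> qq qq' ag zd dd nl.
have [p hp ep] := chi_equal (q d) (q' d); exists p => //.
have ag0 x i : i \in T -> inbox T z x -> q (upd x i ord0) = q' (upd x i ord0).
  by move=> iT zx; apply: ag; [exact: inbox_upd|exists i; rewrite ?upd_eq].
have d0 x i : inbox T z x -> q x != q' x -> i \in T -> x i != ord0.
  by move=> zx dx iT; apply: contraNneq dx => x0; rewrite ag //; exists i.
(* By [line_swap] the values at [d] reappear interchanged at a second point of each line through
   [d]. *)
have /fin_all_exists[e eP] : forall i, exists e, i \in T -> [/\ e != d i, e != ord0,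
    q (upd d i e) = q' d & q' (upd d i e) = q d].
  move=> i; have [iT|iT] := boolP (i \in T); last by exists ord0.
  have [||e] := line_swap (@qq d i) (@qq' d i) (ag0 _ _ iT zd) (d := d i).
  - by rewrite upd_id.
  - exact: nl.
  by rewrite upd_id => eP; exists e.
have sw y : inbox T z y -> (forall i, i \in T -> (y i == d i) || (y i == e i)) ->
    swapped (q d) (q' d) (q y) (q' y).
  move: {2}#|_| (leqnn #|[set i in T | y i != d i]|) => k.
  elim: k y => [|k IH] y cy zy ye.
    have -> : y = d.
      apply/ffunP => i; have [iT|iT] := boolP (i \in T); last by rewrite zy // zd.
      move: cy; rewrite leqn0 => /eqP/cards0_eq/setP/(_ i); rewrite !inE iT /=.
      by case: eqP.
    by rewrite /swapped !eqxx.
  have [yd|] := eqVneq [set i in T | y i != d i] set0.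
    by apply: IH => //; rewrite yd cards0.
  case/set0Pn => i; rewrite inE => /andP[iT yi].
  have yie : y i = e i by have := ye i iT; rewrite (negbTE yi) => /eqP.
  have ci : #|[set l in T | y l != d l] :\ i| <= k.
    by move: cy; rewrite (cardsD1 i) inE iT yi.
  have [yd|] := eqVneq ([set l in T | y l != d l] :\ i) set0.
    have -> : y = upd d i (e i).
      apply/ffunP => l; rewrite ffunE; case: eqP => [->//|/eqP li].
      have [lT|lT] := boolP (l \in T); last by rewrite zy // zd.
      by have /setP/(_ l) := yd; rewrite !inE li lT /=; case: eqP.
    have [_ _ -> ->] := eP i iT.
    by rewrite /swapped !eqxx orbT.
  case/set0Pn => j; rewrite !inE => /and3P[ji jT yj].
  have ij : i != j by rewrite eq_sym.
  have yje : y j = e j by have := ye j jT; rewrite (negbTE yj) => /eqP.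
  (* With at least two coordinates [i], [j] moved away from [d], moving one or both back gives three
     corners covered by induction; [latin2_swap] yields the fourth. *)
  have IHs (S : {set 'I_n}) w : S \subset [set i; j] -> (S != set0) -> inbox T z w ->
      (forall l, w l = if l \in S then d l else y l) ->
      swapped (q d) (q' d) (q w) (q' w).
    move=> sS S0 zw wE; apply: IH => //; last first.
      by move=> l lT; rewrite wE; case: ifP => _; rewrite ?eqxx ?ye.
    have [l lS] := set0Pn _ S0.
    have lT : (l \in T) && (y l != d l).
      by have := subsetP sS l lS; rewrite !inE => /orP[]/eqP->; rewrite ?iT ?jT.
    rewrite -ltnS; apply: leq_trans cy; apply: proper_card; apply/properP; split.
      apply/subsetP => t; rewrite !inE wE; case: (t \in S) => //.
      by rewrite eqxx andbF.
    by exists l; rewrite !inE ?lT // wE lS eqxx andbF.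
  pose u a b := q (upd (upd y i a) j b); pose u' a b := q' (upd (upd y i a) j b).
  have zu a b : inbox T z (upd (upd y i a) j b) by do 2?apply: inbox_upd.
  have s1 : swapped (q d) (q' d) (u (d i) (d j)) (u' (d i) (d j)).
    apply: (IHs [set i; j]) => // [|l]; first by apply/set0Pn; exists i; rewrite !inE eqxx.
    rewrite !ffunE !inE orbC; case: eqP => [->//|_]; by case: eqP => [->|].
  have s2 : swapped (q d) (q' d) (u (e i) (d j)) (u' (e i) (d j)).
    rewrite /u /u' -yie upd_id; apply: (IHs [set j]) => // [|||l].
    - by apply/subsetP => l; rewrite !inE => ->; rewrite orbT.
    - by apply/set0Pn; exists j; rewrite inE.
    - exact: inbox_upd.
    - by rewrite !ffunE !inE; case: eqP => // ->.
  have s3 : swapped (q d) (q' d) (u (d i) (e j)) (u' (d i) (e j)).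
    rewrite /u /u' -yje.
    have -> : upd (upd y i (d i)) j (y j) = upd y i (d i).
      by rewrite -[RHS](upd_id _ j) upd_neq // eq_sym.
    apply: (IHs [set i]) => // [|||l].
    - by apply/subsetP => l; rewrite !inE => ->.
    - by apply/set0Pn; exists i; rewrite inE.
    - exact: inbox_upd.
    - by rewrite !ffunE !inE; case: eqP => // ->.
  have [ei ei0 _ _] := eP i iT; have [ej ej0 _ _] := eP j jT.
  have yE : upd (upd y i (e i)) j (e j) = y by rewrite -yie upd_id -yje upd_id.
  have uu : u (d i) (d j) != u' (d i) (d j).
    case/orP: (s1) => /andP[/eqP/val_inj-> /eqP/val_inj->] //.
    by rewrite eq_sym.
  rewrite -yE -/(u _ _) -/(u' _ _) -(swapped_trans s1).
  apply: (latin2_swap (latin2_plane y qq ij) (latin2_plane y qq' ij)).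
  - by move=> a; apply: ag0 => //; apply: inbox_upd.
  - by move=> b; rewrite !(updC _ _ _ ij); apply: ag0 => //; apply: inbox_upd.
  - move=> b b0; have [|a a0 ea] := nl (upd y j b) i _ iT; first exact: inbox_upd.
    by exists a => //; rewrite !(updC _ _ _ ij).
  - by move=> a a0; apply: nl => //; apply: inbox_upd.
  - exact: d0 zd dd iT.
  - by [].
  - exact: d0 zd dd jT.
  - by [].
  - by rewrite eq_sym.
  - by rewrite eq_sym.
  - exact: uu.
  - by have := s2; rewrite -(swapped_trans s1).
  - by have := s3; rewrite -(swapped_trans s1).
apply: (@box_SL _ _ _ _ _ d e (chi p (q d))) => // [i iT|y zy ye].
  by have [] := eP i iT.
by case/orP: (sw y zy ye) => /andP[/eqP-> _].
Qed.

End Siblings.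

(** * At most two siblings for a given functional *)

Section Separation.

Variable n : nat.
Local Notation point := {ffun 'I_n -> 'I_4}.
Implicit Types (x y z m : point) (T : {set 'I_n}) (q : point -> 'I_4).

Lemma SL_deriv p T z q x y i a b : SL p T z q -> inbox T z x -> inbox T z y ->
  i \in T -> chi p (q (upd x i a)) (+) chi p (q (upd x i b)) =
  chi p (q (upd y i a)) (+) chi p (q (upd y i b)).
Proof.
move=> sl zx zy iT.
move: {2}#|_| (erefl #|[set l | (l != i) && (x l != y l)]|) => k.
elim: k x zx => [|k IH] x zx cx.
  have xy c : upd x i c = upd y i c.
    apply/ffunP => l; rewrite !ffunE; case: eqP => // /eqP li.
    by have /setP/(_ l) := cards0_eq cx; rewrite !inE li; case: eqP.
  by rewrite !xy.
have [l] : exists l, l \in [set l | (l != i) && (x l != y l)].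
  by apply/card_gt0P; rewrite cx.
rewrite inE => /andP[li xl].
have lT : l \in T by apply: contraT => lT; rewrite zx // zy // eqxx in xl.
rewrite -(IH (upd x l (y l))); last first.
- move: cx; rewrite (cardsD1 l) inE li xl => -[<-]; apply: eq_card => j.
  by rewrite !inE ffunE; have [->|_] := eqVneq j l; rewrite ?eqxx ?andbF.
- exact: inbox_upd.
rewrite !(updC _ _ _ li).
have il : i != l by rewrite eq_sym.
have := sl x i l a (y l) zx iT lT il; have := sl x i l b (y l) zx iT lT il.
by do 6![case: (chi p _)].
Qed.

(** The sum of [v] and [w] is the nonzero kernel element of [chi p], on which every other nonzero
    functional is 1. *)
Lemma chi_compl p r (v w : 'I_4) : 0 < p < 4 -> 0 < r < 4 -> p != r -> v != w ->
  chi p v = chi p w -> chi r v = ~~ chi r w.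
Proof.
move=> hp hr pr vw e; have /eqP := vw; have := @eq_of_two_chi p r v w hp hr pr e.
by case: (chi r v); case: (chi r w) => // /(_ erefl).
Qed.

Section TwoSiblings.

Variables (p : nat) (T : {set 'I_n}) (z : point) (q q' : point -> 'I_4).
Hypotheses (hp : 0 < p < 4) (T2 : 1 < #|T|) (qq : quasi q) (qq' : quasi q').
Hypotheses (ag : agree T z q q') (sl : SL p T z q) (sl' : SL p T z q').

(** The class of the common value at [ord0] has one further element. If the value at [x] lay in this
    class, both siblings would have to take that element at [x]. *)
Lemma sibling_diff x i : inbox T z x -> i \in T -> q x != q' x ->
  chi p (q x) != chi p (q (upd x i ord0)).
Proof.
move=> zx iT dx.
have x0 : x i != ord0 by apply: contraNneq dx => x0; rewrite ag //; exists i.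
have z0 : q (upd x i ord0) = q' (upd x i ord0).
  by apply: ag; [exact: inbox_upd|exists i; rewrite ?upd_eq].
apply/eqP => ex.
have := SL_agree_chi T2 ag sl sl' zx.
rewrite (@chi_class p (q (upd x i ord0)) (q x) (q' x)) // ?ex; first by case: chi.
- by rewrite -[in q x](upd_id x i) (inj_eq (@qq x i)) eq_sym.
- by rewrite z0 -[in q' x](upd_id x i) (inj_eq (@qq' x i)).
- by rewrite eq_sym.
Qed.

(** With [sibling_diff], the difference set of two different siblings is determined by [chi p] of
    [q] alone. Moving from [x] to [y] one coordinate at a time keeps the class; a common new value
    would be a third element of it. *)
Lemma sibling_same x y : inbox T z x -> q x != q' x -> inbox T z y ->
  (forall i, i \in T -> chi p (q y) != chi p (q (upd y i ord0))) -> q y != q' y.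
Proof.
move=> zx dx zy yc.
move: {2}#|_| (erefl #|[set l | x l != y l]|) => k.
elim: k x zx dx => [|k IH] x zx dx cx.
  suff <- : x = y by [].
  by apply/ffunP => l; have /setP/(_ l) := cards0_eq cx; rewrite !inE; case: eqP.
have [l] : exists l, l \in [set l | x l != y l] by apply/card_gt0P; rewrite cx.
rewrite inE => xl.
have lT : l \in T by apply: contraT => lT; rewrite zx // zy // eqxx in xl.
pose x' := upd x l (y l); have zx' : inbox T z x' by exact: inbox_upd.
apply: (IH x') => //; last first.
  move: cx; rewrite (cardsD1 l) inE xl => -[<-]; apply: eq_card => j.
  by rewrite !inE ffunE; have [->|_] := eqVneq j l; rewrite ?eqxx ?andbF.
have e1 : chi p (q x') = chi p (q x).
  have := SL_deriv (y l) ord0 sl zx zy lT; rewrite upd_id -/x'.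
  have := yc l lT; have := sibling_diff zx lT dx.
  by do 5![case: (chi p _)].
have n1 : q x' != q x by rewrite -[in q x](upd_id x l) (inj_eq (@qq x l)) eq_sym.
have n2 : q' x' != q' x by rewrite -[in q' x](upd_id x l) (inj_eq (@qq' x l)) eq_sym.
apply/eqP => e; have := SL_agree_chi T2 ag sl sl' zx.
rewrite (@chi_class p (q x') (q x) (q' x)) // ?e1; first by case: chi.
  by rewrite e eq_sym.
by rewrite eq_sym.
Qed.

End TwoSiblings.

(** Where [q2] and [q3] differ, [sibling_same] makes [q1] differ from both, which gives three values
    in one class of [chi p]. *)
Lemma three_siblings p T z q1 q2 q3 : 0 < p < 4 -> 1 < #|T| ->
  quasi q1 -> quasi q2 -> quasi q3 ->
  agree T z q1 q2 -> agree T z q1 q3 ->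
  SL p T z q1 -> SL p T z q2 -> SL p T z q3 ->
  (exists2 x, inbox T z x & q1 x != q2 x) ->
  (exists2 x, inbox T z x & q1 x != q3 x) ->
  forall x, inbox T z x -> q2 x = q3 x.
Proof.
move=> hp T2 qq1 qq2 qq3 ag2 ag3 sl1 sl2 sl3 [x2 zx2 d2] [x3 zx3 d3] x zx.
apply/eqP; apply: contraT => dx.
have ag23 : agree T z q2 q3 by move=> y zy y0; rewrite -ag2 // ag3.
have xc i : i \in T -> chi p (q1 x) != chi p (q1 (upd x i ord0)).
  move=> iT; rewrite !(SL_agree_chi T2 ag2 sl1 sl2) //; last exact: inbox_upd.
  exact: (sibling_diff hp T2 qq2 qq3 ag23 sl2 sl3 zx iT dx).
have n2 := sibling_same hp T2 qq1 qq2 ag2 sl1 sl2 zx2 d2 zx xc.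
have n3 := sibling_same hp T2 qq1 qq3 ag3 sl1 sl3 zx3 d3 zx xc.
have e2 := SL_agree_chi T2 ag2 sl1 sl2 zx.
have := SL_agree_chi T2 ag3 sl1 sl3 zx.
rewrite (@chi_class p (q1 x) (q2 x) (q3 x)) //; first by case: chi.
  by rewrite eq_sym.
by rewrite eq_sym.
Qed.

End Separation.

(** * Semilinearity from a full line in dimension at least 4 *)

Section FullLine.

Variable n : nat.
Local Notation point := {ffun 'I_n -> 'I_4}.
Implicit Types (x y z m : point) (T S : {set 'I_n}).

Variables (k : nat) (T : {set 'I_n}) (z : point) (q q' : point -> 'I_4).
Hypothesis IH : forall S z' r r' d, #|S| = k -> quasi r -> quasi r' ->
  agree S z' r r' -> inbox S z' d -> r d != r' d ->
  exists2 p, 0 < p < 4 & SL p S z' r.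
Hypotheses (k3 : 2 < k) (cT : #|T| = k.+1).
Hypotheses (qq : quasi q) (qq' : quasi q') (ag : agree T z q q').

Definition full_line x i := forall a, a != ord0 -> q (upd x i a) != q' (upd x i a).

Lemma card_side j : j \in T -> #|T :\ j| = k.
Proof. by move=> jT; move: cT; rewrite (cardsD1 j) jT => -[]. Qed.

Lemma card_gt1 : 1 < #|T|. Proof. by rewrite cT ltnS; apply: leq_trans k3. Qed.

Lemma card_side_gt1 j : j \in T -> 1 < #|T :\ j|.
Proof. by move=> jT; rewrite card_side // ltnW. Qed.

Lemma card_side2_gt1 i j : i \in T -> j \in T -> i != j -> 1 < #|T :\ i :\ j|.
Proof.
move=> iT jT ij; move: (card_side iT) k3; rewrite (cardsD1 j) !inE eq_sym ij jT.
by move=> <-.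
Qed.

(** Siblings semilinear for a common functional agree at a second point of every line, by
    [SL_agree_line]. *)
Lemma full_line_apart S m i r : S \subset T -> 1 < #|S| -> i \in S -> inbox T z m ->
  full_line m i -> 0 < r < 4 -> SL r S m q -> SL r S m q' -> False.
Proof.
move=> sS S2 iS zm fl hr sl sl'.
have [a a0 /eqP] := SL_agree_line S2 hr qq qq' (agreeS sS zm ag) sl sl' (inboxxx _ _) iS.
by rewrite (negbTE (fl a a0)).
Qed.

Lemma layer_SL m j : inbox T z m -> j \in T -> q m != q' m ->
  (exists2 p, 0 < p < 4 & SL p (T :\ j) m q) /\
  (exists2 p, 0 < p < 4 & SL p (T :\ j) m q').
Proof.
move=> zm jT dm; have agj : agree (T :\ j) m q q' by apply: (agreeS (subsetDl _ _) zm).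
split; first exact: IH (card_side jT) qq qq' agj (inboxxx _ _) dm.
by apply: IH (card_side jT) qq' qq (agree_sym agj) (inboxxx _ _) _; rewrite eq_sym.
Qed.

(** Two layers through the full line meet in a box of dimension at least 2 containing that line. If
    [q] had different functionals on them, it would have all three on the intersection, including
    that of [q'], against [full_line_apart]. *)
Lemma full_line_layers m i : inbox T z m -> i \in T -> full_line m i ->
  exists p p', [/\ 0 < p < 4, 0 < p' < 4, p != p' & forall j, j \in T -> j != i ->
    SL p (T :\ j) m q /\ SL p' (T :\ j) m q'].
Proof.
move=> zm iT fl.
(* [m] may lie on a side of the box. [m1] is a point of the same line where the siblings differ, and
   it lies in the same layers. *)
pose m1 := upd m i (inord 1).
have d1 : q m1 != q' m1 by apply: fl; rewrite -val_eqE /= inordK.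
have zm1 : inbox T z m1 by exact: inbox_upd.
have layer j : j \in T -> j != i ->
    (exists2 p, 0 < p < 4 & SL p (T :\ j) m q) /\
    (exists2 p, 0 < p < 4 & SL p (T :\ j) m q').
  move=> jT ji; have m1m : inbox (T :\ j) m1 m.
    by move=> l; rewrite ffunE; case: eqP => // ->; rewrite !inE eq_sym ji iT.
  have [[p hp sl] [p' hp' sl']] := layer_SL zm1 jT d1.
  by split; [exists p|exists p'] => //; apply: SLS m1m _.
have [j jT ji] : exists2 j, j \in T & j != i by exact: card_gt1_other card_gt1.
have [[p hp sl] [p' hp' sl']] := layer j jT ji.
exists p, p'.
have iTj : i \in T :\ j by rewrite !inE eq_sym ji.
have pp : p != p'.
  apply/eqP => e; apply: (full_line_apart (subsetDl _ _) _ iTj zm fl hp' _ sl').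
    exact: card_side_gt1.
  by rewrite -e.
split=> // l lT li.
have [->//|lj] := eqVneq l j.
have [[r hr slr] [r' hr' slr']] := layer l lT li.
pose S := T :\ j :\ l.
have sS : S \subset T := subset_trans (subsetDl _ _) (subsetDl _ _).
have sSl : S \subset T :\ l by rewrite /S setDDl setUC -setDDl subsetDl.
have iS : i \in S by rewrite !inE eq_sym li eq_sym ji.
have S2 : 1 < #|S| by apply: card_side2_gt1; rewrite // eq_sym.
have slS := SLS (subsetDl (T :\ j) [set l]) (inboxxx _ m) sl.
have slS' := SLS (subsetDl (T :\ j) [set l]) (inboxxx _ m) sl'.
have slrS := SLS sSl (inboxxx _ m) slr.
have slrS' := SLS sSl (inboxxx _ m) slr'.
split.
  have [->//|pr] := eqVneq p r.
  case: (full_line_apart sS S2 iS zm fl hp' _ slS').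
  exact: SL_third hp hr hp' pr slS slrS.
have [->//|pr] := eqVneq p' r'.
case: (full_line_apart sS S2 iS zm fl hp slS).
exact: SL_third hp' hr' hp pr slS' slrS'.
Qed.

Lemma SL_full_line x0 i : inbox T z x0 -> i \in T -> full_line x0 i ->
  exists2 p, 0 < p < 4 & SL p T z q.
Proof.
move=> zx0 iT fl.
have [p [p' [hp hp' pp lay]]] := full_line_layers zx0 iT fl.
have e0 x j : j \in T -> inbox T z x -> q (upd x j ord0) = q' (upd x j ord0).
  by move=> jT zx; apply: ag; [exact: inbox_upd|exists j; rewrite ?upd_eq].
(* The point [m] is chosen on the full line so that [latin2_cross] makes every line through [m]
   full. *)
have [a [ca ca']] := line_common (@qq x0 i) (@qq' x0 i) hp hp'.
pose m := upd x0 i a; have zm : inbox T z m by exact: inbox_upd.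
have mP j : j \in T -> chi p (q m) != chi p (q (upd m j ord0)) /\ full_line m j.
  move=> jT; have [->|ji] := eqVneq j i.
    by split=> [|b b0]; rewrite /m updU // fl.
  have ij : i != j by rewrite eq_sym.
  pose u r := fun b c => r (upd (upd x0 i b) j c) : 'I_4.
  (* A third direction [l] puts the plane of [i] and [j] into a layer whose functionals are
     known. *)
  have [l lT lij] : exists2 l, l \in T :\ i & l != j.
    exact: card_gt1_other (card_side_gt1 _).
  move: lT; rewrite !inE => /andP[li lT].
  have [sl sl'] := lay l lT li.
  have iTl : i \in T :\ l by rewrite !inE eq_sym li.
  have jTl : j \in T :\ l by rewrite !inE eq_sym lij.
  have ue r b : u r b (x0 j) = r (upd x0 i b).
    by rewrite /u -[in RHS](upd_id (upd x0 i b) j) upd_neq.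
  have x0j : x0 j != ord0.
    have := fl (inord 1); rewrite -val_eqE /= inordK // => /(_ isT).
    apply: contraNneq => x00; rewrite ag //; first exact: inbox_upd.
    by exists j; rewrite // upd_neq.
  have [] := latin2_cross (latin2_plane x0 qq ij) (latin2_plane x0 qq' ij) _ _
    hp hp' pp (SL_sep2 sl (inboxxx _ _) iTl jTl ij)
      (SL_sep2 sl' (inboxxx _ _) iTl jTl ij) x0j _ (a := a) => [b|b|b b0|||].
  - by apply: e0 => //; apply: inbox_upd.
  - by rewrite !(updC _ _ _ ij); apply: e0 => //; apply: inbox_upd.
  - by have := fl b b0; rewrite -(ue q) -(ue q').
  - by move: ca; rewrite -!(ue q).
  - by move: ca'; rewrite -!(ue q').
  move=> c1 c2; split.
    by move: c1; rewrite -/(u q a (x0 j)) ue.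
  by move=> b b0; apply: c2.
have fm j : j \in T -> full_line m j by case/mP.
have apart S l r : S \subset T -> 1 < #|S| -> l \in S -> 0 < r < 4 ->
    SL r S m q -> SL r S m q' -> False.
  by move=> sS S2 lS; apply: (full_line_apart sS S2 lS zm); apply: fm; apply: (subsetP sS).
(* The layer orthogonal to [i] is reached through the full line in another direction [l]; comparison
   on a layer containing both lines identifies the functionals. *)
have laym j : j \in T -> SL p (T :\ j) m q /\ SL p' (T :\ j) m q'.
  have step l : l \in T -> l != i -> SL p (T :\ l) m q /\ SL p' (T :\ l) m q'.
    move=> lT li; have [sl sl'] := lay l lT li.
    have x0m : inbox (T :\ l) x0 m.
      by apply: inbox_upd; rewrite // !inE eq_sym li.
    by split; [exact: SLS x0m sl|exact: SLS x0m sl'].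
  move=> jT; have [ji|] := eqVneq j i; last exact: step.
  have [l lT li] : exists2 l, l \in T & l != i by exact: card_gt1_other card_gt1.
  have [s [s' [hs hs' ss lay']]] := full_line_layers zm lT (fm l lT).
  have [t] : exists2 t, t \in T :\ i & t != l by exact: card_gt1_other (card_side_gt1 _).
  rewrite !inE => /andP[ti tT] tl.
  have [sl sl'] := step t tT ti; have [slt slt'] := lay' t tT tl.
  have [sli sli'] : SL s (T :\ j) m q /\ SL s' (T :\ j) m q'.
    by apply: lay'; rewrite // ji eq_sym.
  have lTt : l \in T :\ t by rewrite !inE eq_sym tl.
  have Tt2 : 1 < #|T :\ t| by exact: card_side_gt1.
  split.
    have [->//|ps] := eqVneq p s.
    case: (apart _ _ _ (subsetDl _ _) Tt2 lTt hp' _ sl').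
    exact: SL_third hp hs hp' ps sl slt.
  have [->//|ps] := eqVneq p' s'.
  case: (apart _ _ _ (subsetDl _ _) Tt2 lTt hp sl).
  exact: SL_third hp' hs' hp ps sl' slt'.
clearbody m.
have /fin_all_exists[e eP] : forall j, exists e, j \in T ->
    [/\ e != m j, e != ord0 & chi p (q (upd m j e)) = chi p (q m)].
  move=> j; have [jT|jT] := boolP (j \in T); last by exists ord0.
  have [e [em ce _]] := line_mate (@qq m j) (m j) hp.
  rewrite upd_id in ce; exists e => _; split=> //.
  by apply: contraNneq (proj1 (mP j jT)) => e0'; rewrite -e0' ce.
(* On the parallel layer at [e j] another functional would make [q] semilinear for [p'] too. Since
   [chi p] agrees at [m j] and [e j], [chi p'] is complemented between them, so [p'] would also
   serve at [m], where [q'] has it. *)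
have laye j : j \in T -> SL p (T :\ j) (upd m j (e j)) q.
  move=> jT; pose m1 := upd m j (e j); have [em en0 ce] := eP j jT.
  have zm1 : inbox T z m1 by exact: inbox_upd.
  have [[r hr slr] _] := layer_SL zm1 jT (fm j jT _ en0).
  have [->//|pr] := eqVneq p r.
  have [t tT tj] : exists2 t, t \in T & t != j by exact: card_gt1_other card_gt1.
  have jt : j != t by rewrite eq_sym.
  pose S := T :\ j :\ t.
  have S2 : 1 < #|S| by exact: card_side2_gt1.
  have sSt : S \subset T :\ t by rewrite /S setDDl setUC -setDDl subsetDl.
  have sS : S \subset T := subset_trans sSt (subsetDl _ _).
  have jTt : j \in T :\ t by rewrite !inE jt.
  have [slt slt'] := laym t tT.
  have slm1 : SL p' S m1 q.
    apply: (SL_third hp hr hp' pr); last exact: SLS (subsetDl _ _) (inboxxx _ _) slr.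
    by apply: SLS sSt _ slt; apply: inbox_upd.
  have [l [_ [lS _ _]]] := card_gt1_pair S2.
  exfalso; apply: (apart S l p' sS S2 lS hp' _ (SLS sSt (inboxxx _ _) slt')).
  have cmpl y : inbox S m y -> chi p' (q y) = ~~ chi p' (q (upd y j (e j))).
    move=> my; have yj : y j = m j by apply: my; rewrite !inE eqxx andbF.
    apply: (chi_compl hp hp' pp).
      by rewrite -[in q y](upd_id y j) (inj_eq (@qq y j)) yj eq_sym.
    have := SL_deriv (e j) (m j) slt (inboxxx _ m) (inboxS sSt (inboxxx _ _) my) jTt.
    by rewrite upd_id -yj upd_id ce addbb; case: chi; case: chi.
  move=> x a1 a2 b1 b2 mx h1 h2 h12.
  have n1 : a1 != j by apply: contraTneq h1 => ->; rewrite !inE eqxx andbF.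
  have n2 : a2 != j by apply: contraTneq h2 => ->; rewrite !inE eqxx andbF.
  have m1x : inbox S m1 (upd x j (e j)).
    by move=> t' t'S; rewrite /m1 !ffunE; case: eqP => // _; exact: mx.
  have := slm1 _ a1 a2 b1 b2 m1x h1 h2 h12.
  rewrite (cmpl (upd (upd x a1 b1) a2 b2)); last by do 2?apply: inbox_upd.
  rewrite (cmpl (upd x a2 b2)) ?(cmpl (upd x a1 b1)) ?(cmpl x) //; do ?exact: inbox_upd.
  by rewrite !(updC _ _ _ n2) !(updC _ _ _ n1) !addbN !addNb !negbK.
exists p => //.
apply: (@box_SL _ _ _ _ _ m e (chi p (q m))) => // [j jT|]; first by have [] := eP j jT.
move=> y; move: {2}#|_| (leqnn #|[set l in T | y l != m l]|) => c.
elim: c y => [|c IHc] y cy zy ye.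
  suff -> : y = m by [].
  apply/ffunP => l; have [lT|lT] := boolP (l \in T); last by rewrite zy // zm.
  move: cy; rewrite leqn0 => /eqP/cards0_eq/setP/(_ l); rewrite !inE lT /=.
  by case: eqP.
have [y0|] := eqVneq [set l in T | y l != m l] set0.
  by apply: IHc => //; rewrite y0 cards0.
case/set0Pn => j; rewrite inE => /andP[jT yj].
have yje : y j = e j by have := ye j jT; rewrite (negbTE yj) => /eqP.
have [y0|] := eqVneq ([set l in T | y l != m l] :\ j) set0.
  suff -> : y = upd m j (e j) by have [] := eP j jT.
  apply/ffunP => l; rewrite ffunE; case: eqP => [->//|/eqP li].
  have [lT|lT] := boolP (l \in T); last by rewrite zy // zm.
  by have /setP/(_ l) := y0; rewrite !inE li lT /=; case: eqP.
case/set0Pn => t; rewrite !inE => /and3P[tj tT yt].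
have jt : j != t by rewrite eq_sym.
have [l] : exists2 l, l \in T :\ j & l != t by exact: card_gt1_other (card_side_gt1 _).
(* With [j] and [t] moved, a third direction [l] gives a layer through [y] known to be semilinear
   for [p]; its mixed difference in [j] and [t] reduces [y] to points with fewer moved
   coordinates. *)
rewrite !inE => /andP[lj lT] lt.
have sly : SL p (T :\ l) y q.
  have /orP[/eqP yl|/eqP yl] := ye l lT.
    apply: SLS (subxx _) _ (proj1 (laym l lT)) => s; rewrite !inE negb_and negbK.
    by case/orP => [/eqP->//|sT]; rewrite zy // zm.
  apply: SLS (subxx _) _ (laye l lT) => s; rewrite !inE negb_and negbK ffunE.
  by case: eqP => [->//|_] /= sT; rewrite zy // zm.
pose w := upd (upd y j (m j)) t (m t).
have zw : inbox T z w by do 2?apply: inbox_upd.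
have yw : inbox (T :\ l) y w.
  by do 2?apply: inbox_upd; rewrite // !inE eq_sym ?lj ?lt.
have jTl : j \in T :\ l by rewrite !inE eq_sym lj.
have tTl : t \in T :\ l by rewrite !inE eq_sym lt.
have := sly w j t (y j) (y t) yw jTl tTl jt.
have -> : upd (upd w j (y j)) t (y t) = y.
  by rewrite /w (updC _ _ _ tj) !updU !upd_id.
have -> : upd w t (y t) = upd y j (m j).
  by rewrite /w updU -[in LHS](@upd_neq _ y j (m j) t) // upd_id.
have -> : upd w j (y j) = upd y t (m t).
  by rewrite /w (updC _ _ _ tj) updU upd_id.
have le_c (v : point) s : s \in [set l in T | y l != m l] -> v s = m s ->
    (forall r, v r != m r -> y r = v r) -> #|[set l in T | v l != m l]| <= c.
  move=> sy vs vr; rewrite -ltnS; apply: leq_trans cy; apply: proper_card.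
  apply/properP; split; last by exists s => //; rewrite !inE vs eqxx andbF.
  by apply/subsetP => r; rewrite !inE => /andP[-> vm] /=; rewrite (vr r vm).
have jy : j \in [set l in T | y l != m l] by rewrite inE jT.
have ty : t \in [set l in T | y l != m l] by rewrite inE tT.
have mr (v : point) : (forall r, v r = y r \/ v r = m r) ->
    forall r, r \in T -> (v r == m r) || (v r == e r).
  by move=> vr r rT; case: (vr r) => ->; rewrite ?eqxx ?ye.
have -> : chi p (q (upd y j (m j))) = chi p (q m).
  apply: IHc; [apply: (le_c _ _ jy)|exact: inbox_upd|apply: mr] => [|r|r];
    rewrite ?upd_eq // !ffunE; have [->|_] := eqVneq r j; rewrite ?eqxx //;
    first [by left | by right].
have -> : chi p (q (upd y t (m t))) = chi p (q m).
  apply: IHc; [apply: (le_c _ _ ty)|exact: inbox_upd|apply: mr] => [|r|r];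
    rewrite ?upd_eq // !ffunE; have [->|_] := eqVneq r t; rewrite ?eqxx //;
    first [by left | by right].
have -> : chi p (q w) = chi p (q m).
  apply: IHc; [apply: (le_c _ _ jy)|exact: zw|apply: mr] => [|r|r]; rewrite /w.
  - by rewrite upd_neq // upd_eq.
  - rewrite !ffunE.
    by have [->|_] := eqVneq r t; [|have [->|_] := eqVneq r j]; rewrite ?eqxx.
  - by rewrite !ffunE; case: eqP => [->|_]; [right|case: eqP => [->|_]; [right|left]].
by do 2![case: (chi _ _)].
Qed.

End FullLine.

Lemma SL_of_siblings n (T : {set 'I_n}) z (q q' : {ffun 'I_n -> 'I_4} -> 'I_4) d :
  1 < #|T| -> quasi q -> quasi q' -> agree T z q q' -> inbox T z d -> q d != q' d ->
  exists2 p, 0 < p < 4 & SL p T z q.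
Proof.
move: {2}#|T| (erefl #|T|) => k.
elim: k T z q q' d => [|k IH] T z q q' d cT; first by rewrite cT.
move=> T2 qq qq' ag zd dd.
(* As [#|T|] is [k.+1], the first case is dimension at least 4 and the second leaves dimensions 2
   and 3. *)
have [k3|k2] := ltnP 2 k.
  have [[x [i [zx iT fl]]]|nfl] :=
    boolp.EM (exists x i, [/\ inbox T z x, i \in T & full_line q q' x i]).
    apply: (SL_full_line _ k3 cT qq qq' ag zx iT fl).
    by move=> S z' r r' d' cS; apply: IH; rewrite // cS ltnW.
  apply: SL_swap qq qq' ag zd dd _ => x i zx iT.
  apply: boolp.contrapT => ne; apply: nfl; exists x, i; split=> // a a0.
  by apply/eqP => e; apply: ne; exists a.
have [T3|T3] := eqVneq #|T| 3; first exact: SL_cube T3 qq qq' ag zd dd.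
by apply: SL_square => //; lia.
Qed.

(** * Affine faces and extensions from their sides *)

Section Codes.

Variable n : nat.
Local Notation point := {ffun 'I_n -> 'I_4}.
Implicit Types (x y : point) (T S : {set 'I_n}) (q : {ffun point -> 'I_4}).

Lemma quasiP q : is_quasigroup q -> quasi q.
Proof.
move=> /forallP qq x i a b eab; apply/eqP; apply: contraT => ab.
have dif : differ_in_one (upd x i a) (upd x i b).
  rewrite /differ_in_one; have -> : [set j | upd x i a j != upd x i b j] = [set i].
    apply/setP => j; rewrite !inE; have [->|ji] := eqVneq j i; first by rewrite !upd_eq.
    by rewrite !upd_neq // eqxx.
  by rewrite cards1.
by have /forallP/(_ (upd x i b))/implyP/(_ dif) := qq (upd x i a); rewrite eab eqxx.
Qed.

Definition origin : point := [ffun=> ord0].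

Lemma upd_origin0 i : upd origin i ord0 = origin.
Proof. by rewrite -[RHS](upd_id _ i) ffunE. Qed.

(** * Codes of quasigroups *)

Definition affine_sum s (q : point -> 'I_4) x := chi s (q origin) (+)
  \big[addb/false]_(i < n) (chi s (q (upd origin i (x i))) (+) chi s (q origin)).

(** This is the sum, in F_2^2, of functions of one coordinate that has the same axes as [q]. *)
Definition affine (q : point -> 'I_4) : {ffun point -> 'I_4} :=
  [ffun x => of_bits (affine_sum 1 q x) (affine_sum 2 q x)].

Lemma chi_affine s (q : point -> 'I_4) x : 0 < s < 3 ->
  chi s (affine q x) = affine_sum s q x.
Proof.
by case: s => [|[|[|//]]] // _; rewrite ffunE ?of_bitsK1 ?of_bitsK2.
Qed.

Lemma SL_affine s T z (q : point -> 'I_4) : 0 < s < 4 -> SL s T z (affine q).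
Proof.
have sl r : 0 < r < 3 -> SL r T z (affine q).
  move=> hr; pose F i a := chi r (q (upd origin i a)) (+) chi r (q origin).
  apply: (@sep_SL _ _ _ _ _ F (chi r (q origin) (+)
    \big[addb/false]_(i < n | i \notin T) F i (z i))) => x zx.
  rewrite chi_affine // /affine_sum (bigID (mem T)) /= -addbA; congr addb.
  rewrite addbC; congr addb.
  by apply: eq_bigr => i iT; rewrite /F zx.
by move=> hs; apply: (@SL_third _ 1 2) => //; apply: sl.
Qed.

Lemma affine_sum_upd s (q : point -> 'I_4) x i a : affine_sum s q (upd x i a) =
  chi s (q (upd origin i a)) (+) chi s (q (upd origin i (x i))) (+) affine_sum s q x.
Proof.
rewrite /affine_sum (bigD1 i) //= [in RHS](bigD1 i) //= upd_eq.
under eq_bigr => j ji do rewrite upd_neq //.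
set B := \big[_/_]_(_ | _) _.
by case: (chi s (q (upd origin i a))); case: (chi s (q (upd origin i (x i))));
  case: (chi s (q origin)); case: B.
Qed.

Lemma quasi_affine (q : point -> 'I_4) : quasi q -> quasi (affine q).
Proof.
move=> qq x i a b eab; apply: (@qq origin i).
have e s : 0 < s < 3 -> chi s (q (upd origin i a)) = chi s (q (upd origin i b)).
  move=> hs; have := congr1 (chi s) (congr1 (@nat_of_ord 4) eab).
  rewrite !chi_affine // !affine_sum_upd.
  by move/addIb/addIb.
by apply: chi_inj12; apply: e.
Qed.

Lemma affine_axis (q : point -> 'I_4) i a : affine q (upd origin i a) = q (upd origin i a).
Proof.
apply: chi_inj12; rewrite chi_affine // affine_sum_upd !ffunE upd_origin0;
rewrite /affine_sum big1 => [|j _]; rewrite ?ffunE ?upd_origin0 ?addbb //;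
by rewrite addbF -addbA addbb addbF.
Qed.

Lemma affine_ext (q q' : point -> 'I_4) :
  (forall i a, q (upd origin i a) = q' (upd origin i a)) -> q origin = q' origin ->
  affine q = affine q'.
Proof.
move=> ax o; apply/ffunP => x; rewrite !ffunE /affine_sum o.
by congr of_bits; congr addb; apply: eq_bigr => i _; rewrite ax.
Qed.

Definition face T x := [forall i, (i \notin T) ==> (x i == ord0)].

Lemma faceP T x : reflect (inbox T origin x) (face T x).
Proof.
apply: (iffP forallP) => h i; first by move=> iT; rewrite ffunE; apply/eqP/(implyP (h i)).
by apply/implyP => /h ->; rewrite ffunE.
Qed.

Definition linear_on T q := [forall x, face T x ==> (q x == affine q x)].

Lemma linear_onP T q :
  reflect (forall x, inbox T origin x -> q x = affine q x) (linear_on T q).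
Proof.
apply: (iffP forallP) => h x; first by move=> /faceP fx; apply/eqP/(implyP (h x)).
by apply/implyP => /faceP/h ->.
Qed.

Lemma linear_onS S T q : S \subset T -> linear_on T q -> linear_on S q.
Proof.
move=> ST /linear_onP h; apply/linear_onP => x xS; apply: h.
exact: inboxS ST (inboxxx _ _) xS.
Qed.

(** As the coordinates are set to [ord0] one at a time, [q] and [affine q] change equally under both
    functionals, by [SL_deriv]. *)
Lemma SL_linear T q : SL 1 T origin q -> SL 2 T origin q -> linear_on T q.
Proof.
move=> sl1 sl2; apply/linear_onP => x xT.
suff e s : 0 < s < 3 -> SL s T origin q -> chi s (q x) = chi s (affine q x).
  by apply: chi_inj12; apply: e.
move=> hs sl.
move: {2}#|_| (erefl #|[set i | x i != ord0]|) => k.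
elim: k x xT => [|k IH] x xT cx.
  have -> : x = origin.
    by apply/ffunP => i; have /setP/(_ i) := cards0_eq cx; rewrite !inE ffunE; case: eqP.
  rewrite chi_affine // /affine_sum big1 ?addbF // => i _.
  by rewrite ffunE upd_origin0 addbb.
have [i] : exists i, i \in [set i | x i != ord0] by apply/card_gt0P; rewrite cx.
rewrite inE => xi.
have iT : i \in T by apply: contraT => iT; rewrite xT // ffunE eqxx in xi.
have hs4 : 0 < s < 4 by case/andP: hs => -> /ltnW.
have e1 := SL_deriv (x i) ord0 sl xT (inboxxx _ _) iT.
have := SL_deriv (x i) ord0 (@SL_affine s T origin q hs4) xT (inboxxx _ _) iT.
rewrite !affine_axis -e1 !upd_id -(IH (upd x i ord0)).
- by move/addIb.
- exact: inbox_upd.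
move: cx; rewrite (cardsD1 i) inE xi => -[<-]; apply: eq_card => j.
by rewrite !inE ffunE; have [->|_] := eqVneq j i; rewrite ?eqxx ?andbF.
Qed.

Lemma linear_on_small T q : #|T| <= 1 -> linear_on T q.
Proof.
move=> cT; apply/linear_onP => x xT.
have [T0|[i iT]] := set_0Vmem T.
  have -> : x = origin by apply/ffunP => i; rewrite xT // T0 inE.
  apply: chi_inj12; rewrite chi_affine // /affine_sum big1 ?addbF // => j _;
  by rewrite ffunE upd_origin0 addbb.
have -> : x = upd origin i (x i).
  apply/ffunP => j; rewrite ffunE; have [->//|ji] := eqVneq j i.
  apply: xT; apply: contra ji => jT; apply/eqP.
  by have /card_le1_eqP := cT; apply.
by rewrite affine_axis.
Qed.

Definition sides_linear T q := [forall i in T, linear_on (T :\ i) q].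

Definition agreeb T (r q : {ffun point -> 'I_4}) :=
  [forall x, face T x && [exists i in T, x i == ord0] ==> (r x == q x)].

Lemma agreebP T (r q : {ffun point -> 'I_4}) :
  reflect (agree T origin r q) (agreeb T r q).
Proof.
apply: (iffP forallP) => h x.
  move=> /faceP fx [i iT x0]; apply/eqP/(implyP (h x)); rewrite fx /=.
  by apply/existsP; exists i; rewrite iT x0 eqxx.
apply/implyP => /andP[/faceP fx /existsP[i /andP[iT /eqP x0]]].
by apply/eqP/h => //; exists i.
Qed.

(* [rep T q] depends only on the restrictions of [q] to the sides of the face [T]. *)
Definition rep T q :=
  odflt q [pick r : {ffun point -> 'I_4} | is_quasigroup r && agreeb T r q].

(** The value 3 is also a default; [SL_slope] justifies it for a non-affine face of a quasigroup
    with affine sides. *)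
Definition slope T q :=
  if boolp.asbool (SL 1 T origin q) then 1
  else if boolp.asbool (SL 2 T origin q) then 2 else 3.

Definition code q T :=
  if linear_on T q then 0
  else if sides_linear T q then slope T q
  else if [forall x, face T x ==> (q x == rep T q x)] then 1 else 2.

Lemma code_linear T q : (code q T == 0) = linear_on T q.
Proof.
by rewrite /code /slope; do ![case: ifP => //].
Qed.

Lemma code_lt4 T q : code q T < 4.
Proof. by rewrite /code /slope; do ![case: ifP => //]. Qed.

(** A proper subface lies in a side of [T], so that side is not affine and only the last case of
    [code] remains. *)
Lemma code_above S T q : S \proper T -> code q S != 0 -> (code q T == 1) || (code q T == 2).
Proof.
rewrite code_linear => /properP[ST [i iT iS]] nl; rewrite /code.
have nlT : ~~ linear_on (T :\ i) q.
  by apply: contra nl; apply: linear_onS; rewrite subsetD1 ST.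
have -> : linear_on T q = false.
  by apply: contraNF nlT; apply: linear_onS; apply: subsetDl.
have -> : sides_linear T q = false.
  by apply: contraNF nlT => /forallP/(_ i)/implyP; apply.
by case: ifP.
Qed.

Lemma agree_affine T q : sides_linear T q -> agree T origin (affine q) q.
Proof.
move=> sd x xT [i iT x0].
have /forallP/(_ i)/implyP/(_ iT)/linear_onP h := sd; rewrite h //.
move=> j; rewrite !inE negb_and negbK ffunE => /orP[/eqP->//|jT].
by rewrite xT // ffunE.
Qed.

Lemma nonlinear_diff T q : ~~ linear_on T q ->
  exists2 x, inbox T origin x & affine q x != q x.
Proof.
by move=> /forallPn[d]; rewrite negb_imply eq_sym => /andP[/faceP dT dd]; exists d.
Qed.

Lemma SL_slope T q : is_quasigroup q -> 1 < #|T| -> sides_linear T q -> ~~ linear_on T q ->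
  SL (slope T q) T origin q.
Proof.
move=> qq T2 sd nl.
have agq := agree_sym (agree_affine sd).
have [d dT] := nonlinear_diff nl; rewrite eq_sym => dd.
have [p hp sl] := SL_of_siblings T2 (quasiP qq) (quasi_affine (quasiP qq)) agq dT dd.
rewrite /slope; case: boolp.asboolP => // n1; case: boolp.asboolP => // n2.
by case: p hp sl n1 n2 => [|[|[|[|]]]].
Qed.

Lemma rep_quasi T q : is_quasigroup q ->
  is_quasigroup (rep T q) /\ agree T origin (rep T q) q.
Proof.
move=> qq; rewrite /rep; case: pickP => [r /andP[qr /agreebP ag]|] //=.
Qed.

Lemma rep_eq T q q' : is_quasigroup q -> agree T origin q q' -> rep T q = rep T q'.
Proof.
move=> qq ag; rewrite /rep.
have E : (fun r => is_quasigroup r && agreeb T r q) =1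
         (fun r => is_quasigroup r && agreeb T r q').
  move=> r; congr andb; apply/agreebP/agreebP => h x xT x0; rewrite h //; [|symmetry];
  exact: ag.
(* The default of [rep] is never reached, because [q] itself satisfies the predicate. *)
rewrite (eq_pick E); case: pickP => //= /(_ q).
by rewrite qq; move/agreebP: ag => ->.
Qed.

Lemma SL_ext p T z (q q' : point -> 'I_4) : (forall x, inbox T z x -> q x = q' x) ->
  SL p T z q -> SL p T z q'.
Proof.
move=> e sl x i j a b zx iT jT ij; rewrite -!e //; do ?exact: inbox_upd; first exact: sl.
by do 2?apply: inbox_upd.
Qed.

(** All three extensions have the same functional: two different ones would make the common
    non-affine side affine. Then [three_siblings] applies. *)
Lemma three_nonlinear T (q1 q2 q3 : {ffun point -> 'I_4}) : 1 < #|T| ->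
  is_quasigroup q1 -> is_quasigroup q2 -> is_quasigroup q3 ->
  agree T origin q1 q2 -> agree T origin q1 q3 -> ~~ sides_linear T q1 ->
  (exists2 x, inbox T origin x & q1 x != q2 x) ->
  (exists2 x, inbox T origin x & q1 x != q3 x) ->
  forall x, inbox T origin x -> q2 x = q3 x.
Proof.
move=> T2 /quasiP qq1 /quasiP qq2 /quasiP qq3 ag2 ag3 sd [x2 xT2 d2] [x3 xT3 d3].
have [p1 hp1 sl1] := SL_of_siblings T2 qq1 qq2 ag2 xT2 d2.
have [p2 hp2 sl2] : exists2 p, 0 < p < 4 & SL p T origin q2.
  by apply: (SL_of_siblings T2 qq2 qq1 (agree_sym ag2) xT2); rewrite eq_sym.
have [p3 hp3 sl3] : exists2 p, 0 < p < 4 & SL p T origin q3.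
  by apply: (SL_of_siblings T2 qq3 qq1 (agree_sym ag3) xT3); rewrite eq_sym.
have /forallPn[i] := sd; rewrite negb_imply => /andP[iT nl].
have same p (r : {ffun point -> 'I_4}) : 0 < p < 4 -> SL p T origin r ->
    agree T origin q1 r -> p = p1.
  move=> hp sl ag; apply/eqP; apply: contraNT nl => pp.
  have slr : SL p (T :\ i) origin q1.
    apply: SL_ext (SLS (subsetDl _ _) (inboxxx _ _) sl) => x xTi.
    apply/esym/ag; first exact: inboxS (subsetDl _ _) (inboxxx _ _) xTi.
    by exists i; rewrite // xTi ?ffunE // !inE eqxx.
  have slp := SLS (subsetDl T [set i]) (inboxxx _ _) sl1.
  by apply: SL_linear; apply: (SL_third hp hp1 _ pp slr slp).
have e2 := same _ _ hp2 sl2 ag2; have e3 := same _ _ hp3 sl3 ag3; subst p2 p3.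
apply: (three_siblings hp1 T2 qq1 qq2 qq3 ag2 ag3 sl1 sl2 sl3); [by exists x2|by exists x3].
Qed.

(** Induction on the dimension of the face: the restrictions to the sides agree, and the code
    selects the extension. *)
Lemma code_inj q q' : is_quasigroup q -> is_quasigroup q' ->
  (forall i a, q (upd origin i a) = q' (upd origin i a)) -> q origin = q' origin ->
  (forall T, code q T = code q' T) -> q = q'.
Proof.
move=> qq qq' ax o eqc; have eaff := affine_ext ax o.
suff h T : forall x, inbox T origin x -> q x = q' x.
  by apply/ffunP => x; apply: (h [set: 'I_n]) => i; rewrite inE.
move: {2}#|T| (erefl #|T|) => k; elim/ltn_ind: k T => k IH T cT x xT.
have eL : linear_on T q = linear_on T q' by rewrite -!code_linear eqc.
have [lin|nl] := boolP (linear_on T q).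
  move: lin (lin); rewrite {2}eL => /linear_onP -> // /linear_onP -> //.
  by rewrite eaff.
have nl' : ~~ linear_on T q' by rewrite -eL.
have T2 : 1 < #|T| by rewrite ltnNge; apply: contra nl; apply: linear_on_small.
have ag : agree T origin q q'.
  move=> y yT [i iT y0]; apply: (IH #|T :\ i| _ (T :\ i)) => //.
    by rewrite -cT (cardsD1 i T) iT.
  move=> j; rewrite !inE negb_and negbK ffunE => /orP[/eqP->//|jT].
  by rewrite yT // ffunE.
have esd : sides_linear T q = sides_linear T q'.
  apply: eq_forallb => i; have [iT|//] := boolP (i \in T); rewrite !implyTb.
  apply: eq_forallb => y; rewrite -eaff.
  have [/faceP yT|//] := boolP (face (T :\ i) y).
  rewrite ag //; first exact: inboxS (subsetDl _ _) (inboxxx _ _) yT.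
  by exists i; rewrite // yT ?ffunE // !inE eqxx.
have [sd|nsd] := boolP (sides_linear T q).
  have cs : slope T q = slope T q'.
    by have := eqc T; rewrite /code (negbTE nl) (negbTE nl') -esd sd.
  have hs : 0 < slope T q < 4 by rewrite /slope; do ![case: ifP].
  have sd' : sides_linear T q' by rewrite -esd.
  (* [q] and [q'] are both siblings of [affine q], different from it and semilinear for the same
     functional. *)
  apply: (@three_siblings _ (slope T q) T origin (affine q) q q') => //.
  - exact/quasi_affine/quasiP.
  - exact: quasiP.
  - exact: quasiP.
  - exact: agree_affine.
  - by rewrite eaff; apply: agree_affine.
  - exact: SL_affine.
  - exact: SL_slope.
  - by rewrite cs; apply: SL_slope.
  - exact: nonlinear_diff.
  - by rewrite eaff; apply: nonlinear_diff.
have [qr agr] := rep_quasi T qq.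
have er := rep_eq qq ag.
have := eqc T; rewrite /code (negbTE nl) (negbTE nl') -esd (negbTE nsd) -er.
case: ifP => [/forallP h|/negbT/forallPn[d hd]];
  case: ifP => [/forallP h'|/negbT/forallPn[d' hd']] // _.
  have /faceP fx := xT; have := h x; have := h' x.
  by rewrite fx /= => /eqP -> /eqP ->.
move: hd hd'; rewrite !negb_imply => /andP[/faceP dT dd] /andP[/faceP dT' dd'].
(* If they differed, [q] would have the siblings [rep T q] and [q'], which would coincide, although
   [q'] differs from [rep T q] at [d']. *)
apply/eqP; apply: contraT => dx.
have := three_nonlinear T2 qq qr qq' (agree_sym agr) ag nsd.
move=> /(_ (ex_intro2 _ _ d dT dd) (ex_intro2 _ _ x xT dx) d' dT') e.
by rewrite -e eqxx in dd'.
Qed.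

End Codes.

(** * Symmetric chains *)

Section SymmetricChains.

Implicit Types (s t : bitseq) (c : seq bitseq) (C : seq (seq bitseq)).

(* A chain A_1, ..., A_k in the cube of dimension n gives the chains
   A_1, ..., A_k, A_k + {n} and A_1 + {n}, ..., A_(k-1) + {n}. *)
Definition chain_step c : seq (seq bitseq) :=
  let big := rcons [seq false :: s | s <- c] (true :: last [::] c) in
  let small := [seq true :: s | s <- take (size c).-1 c] in
  if size c <= 1 then [:: big] else [:: big; small].

Fixpoint chains n : seq (seq bitseq) :=
  if n is n'.+1 then flatten [seq chain_step c | c <- chains n'] else [:: [:: [::]]].

Lemma chain_step_rcons c s : chain_step (rcons c s) =
  rcons [seq false :: t | t <- rcons c s] (true :: s) ::
    (if c is [::] then [::] else [:: [seq true :: t | t <- c]]).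
Proof.
rewrite /chain_step last_rcons size_rcons /= -[X in take _ X]cats1 take_size_cat //.
by case: c.
Qed.

Definition subbits s t := all2 implb s t && (s != t).

(** The ranks run through consecutive values from [r] to [n - r]. *)
Definition symmetric_chain n c := exists2 r, 2 * r + size c = n.+1 &
  map (count id) c = iota r (size c).

Lemma subbits_cons b s t : subbits (b :: s) (b :: t) = subbits s t.
Proof. by rewrite /subbits /= eqseq_cons eqxx implybb. Qed.

Lemma sorted_map_cons b c : sorted subbits [seq b :: s | s <- c] = sorted subbits c.
Proof. by rewrite sorted_map; apply: eq_sorted => s t; rewrite /= subbits_cons. Qed.

Lemma sorted_rcons2 (r : rel bitseq) c x y :
  sorted r (rcons (rcons c x) y) = sorted r (rcons c x) && r x y.
Proof. by case: c => [|a c] /=; rewrite ?andbT // rcons_path last_rcons. Qed.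

(** From ranks [r] to [n - r], the long new chain has ranks [r] to [n + 1 - r] and the short one
    [r + 1] to [n - r]; both are symmetric in dimension [n + 1]. *)
Lemma chainsP n c : c \in chains n ->
  [/\ 0 < size c, symmetric_chain n c, sorted subbits c & all (fun s => size s == n) c].
Proof.
elim: n c => [|n IH] c.
  by rewrite inE => /eqP ->; split=> //; exists 0.
move=> /flatten_mapP[d /IH[d0 [r rd cd] sd ad]].
case/lastP: d d0 rd cd sd ad => // d x _ rd cd sd ad.
have map_iota m k : map succn (iota m k) = iota m.+1 k by rewrite -[m.+1]add1n iotaDl.
rewrite chain_step_rcons inE => /orP[/eqP ->|cin].
- split.
  + by rewrite size_rcons.
  + exists r; first by move: rd; rewrite !size_rcons size_map size_rcons; lia.
    rewrite map_rcons -map_comp size_rcons size_map size_rcons -addn1 iotaD cats1.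
    rewrite -(size_rcons d x) -cd; congr rcons; rewrite /= add1n.
    have := cd; rewrite map_rcons size_rcons -addn1 iotaD cats1 => /rcons_inj[_ ->].
    by rewrite addn1 addnS.
  + move: sd; rewrite map_rcons sorted_rcons2 -map_rcons sorted_map_cons => ->.
    rewrite /subbits /= andbT; elim: (x) => //= b s ->; by rewrite implybb.
  + move: ad; rewrite all_rcons all_rcons all_map all_rcons /= => /andP[/eqP-> ad].
    by rewrite !eqxx; apply: ad.
- have {cin} [d0 ->] : 0 < size d /\ c = [seq true :: s | s <- d].
    by case: (d) cin => // a l; rewrite inE => /eqP ->.
  split.
  + by rewrite size_map.
  + exists r.+1; first by move: rd; rewrite size_map size_rcons; lia.
    rewrite size_map -map_comp -map_iota.
    have := cd; rewrite map_rcons size_rcons -addn1 iotaD cats1 => /rcons_inj[<- _].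
    by rewrite -map_comp.
  + by rewrite sorted_map_cons; move: sd; rewrite -cats1 => /cat_sorted2[].
  + by rewrite all_map; move: ad; rewrite all_rcons => /andP[].
Qed.

(** An arbitrary predicate lets one recursion express the partition of the cube; rank counts, total
    size and membership follow from it. *)
Lemma count_chains P n : count P (flatten (chains n.+1)) =
  count (fun s => P (false :: s)) (flatten (chains n)) +
  count (fun s => P (true :: s)) (flatten (chains n)).
Proof.
have: all (fun c => 0 < size c) (chains n) by apply/allP => c /chainsP[].
rewrite /=; elim: (chains n) => //= c C IH /andP[c0 /IH{}IH].
rewrite !flatten_cat !count_cat IH addnACA; congr addn.
case/lastP: c c0 => // c x _; rewrite chain_step_rcons.
have -> : count P (flatten (rcons [seq false :: t | t <- rcons c x] (true :: x) ::
    match c with [::] => [::] | _ :: _ => [:: [seq true :: t | t <- c]] end)) =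
  count P (rcons [seq false :: t | t <- rcons c x] (true :: x)) +
  count P [seq true :: t | t <- c].
  have fl (a : seq bitseq) b : flatten (a :: b) = a ++ flatten b by [].
  by rewrite fl count_cat; congr addn; case: (c) => // a l; rewrite fl cats0.
rewrite -[in LHS]cats1 count_cat count_map -addnA; congr addn.
by rewrite count_map -[in RHS]cats1 count_cat /= addn0 addnC.
Qed.

Lemma count_chains_rank n k :
  count (fun s => count id s == k) (flatten (chains n)) = 'C(n, k).
Proof.
elim: n k => [|n IH] k; first by rewrite /= addn0 bin0n eq_sym.
rewrite count_chains /=.
have -> : count (fun s => 0 + count id s == k) (flatten (chains n)) = 'C(n, k).
  exact: IH.
case: k => [|k]; last by rewrite binS -(IH k).
rewrite (@eq_count _ _ pred0) ?count_pred0 ?addn0 ?bin0 //.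
Qed.

(** Each symmetric chain meets the middle rank exactly once. *)
Lemma size_chains n : size (chains n) = 'C(n, n %/ 2).
Proof.
rewrite -count_chains_rank count_flatten.
have /eq_in_map -> : {in chains n, count (fun s => count id s == n %/ 2) =1 fun=> 1}.
  move=> c /chainsP[c0 [r rc cc] _ _].
  have -> : count (fun s => count id s == n %/ 2) c = count_mem (n %/ 2) (map (count id) c).
    by rewrite count_map.
  rewrite cc count_uniq_mem ?iota_uniq // mem_iota.
  suff -> : r <= n %/ 2 < r + size c by [].
  by move: c0 rc; move: (size c) => m c0 rc; apply/andP; split; lia.
by elim: (chains n) => //= c C ->.
Qed.

Lemma sumn_size_chains n : sumn (map size (chains n)) = 2 ^ n.
Proof.
rewrite -[map size _]/(shape _) -size_flatten -count_predT; elim: n => // n IH.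
by rewrite count_chains -![count _ _]/(count predT _) IH expnS mul2n -addnn.
Qed.

Lemma mem_chains n s : size s = n -> exists2 c, c \in chains n & s \in c.
Proof.
move=> sn; apply/flattenP; rewrite -has_pred1 has_count.
elim: n s sn => [|n IH] [|b s] // [/IH h]; rewrite count_chains addn_gt0.
apply/orP; case: b; [right|left]; rewrite (eq_count (a2 := pred1 s)) // => t /=;
  by rewrite eqseq_cons eqxx.
Qed.

End SymmetricChains.

(** * Counting *)

Fixpoint prods (A : Type) (Ls : seq (seq A)) : seq (seq A) :=
  if Ls is L :: Ls' then [seq a :: w | a <- L, w <- prods Ls'] else [:: [::]].

Lemma size_prods A (Ls : seq (seq A)) : size (prods Ls) = \prod_(L <- Ls) size L.
Proof.
elim: Ls => [|L Ls IH]; first by rewrite big_nil.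
by rewrite big_cons size_allpairs IH.
Qed.

Lemma cons_prods (A : eqType) (a : A) w L Ls :
  a \in L -> w \in prods Ls -> a :: w \in prods (L :: Ls).
Proof. exact: allpairs_f. Qed.

Lemma map_in_prods (A B : eqType) (f : B -> A) (g : B -> seq A) s :
  {in s, forall x, f x \in g x} -> map f s \in prods (map g s).
Proof.
elim: s => // x s IH fg; apply: cons_prods; first by apply: fg; rewrite mem_head.
by apply: IH => y ys; apply: fg; rewrite inE ys orbT.
Qed.

(* The possible codes along a chain of k faces. *)
Fixpoint words k : seq (seq nat) :=
  if k is k'.+1 then
    [seq 0 :: w | w <- words k'] ++
    [seq c :: w | c <- [:: 1; 2; 3], w <- prods (nseq k' [:: 1; 2])]
  else [:: [::]].

Lemma wordsS k : words k.+1 = [seq 0 :: w | w <- words k] ++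
  [seq c :: w | c <- [:: 1; 2; 3], w <- prods (nseq k [:: 1; 2])].
Proof. by []. Qed.

Lemma size_words k : size (words k) <= 3 * 2 ^ k.
Proof.
(* The exact size is 3 * 2^k - 2: prefixing 0 keeps the old words, and a nonzero first letter adds 3
   * 2^k new ones. *)
suff : (size (words k)).+2 = 3 * 2 ^ k by lia.
elim: k => // k IH; rewrite wordsS size_cat size_map size_allpairs size_prods big_nseq expnS.
have -> : iter k (muln (size [:: 1; 2])) 1 = 2 ^ k.
  by elim: (k) => //= m ->; rewrite expnS.
by move: IH; rewrite /=; lia.
Qed.

Definition above (a b : nat) := (a != 0) ==> ((b == 1) || (b == 2)).

Lemma words_complete w : sorted above w -> all (fun a => a < 4) w -> w \in words (size w).
Proof.
elim: w => // a w IH aw /andP[a4 w4].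
rewrite [size _]/= wordsS mem_cat; apply/orP.
have [a0|a0] := posnP a.
  by left; rewrite a0; apply: map_f; apply: IH; rewrite ?(path_sorted aw).
right; apply: allpairs_f; first by move: a4 a0; case: a {aw} => [|[|[|[|]]]].
elim: w a a0 aw {IH w4 a4} => // b w IH a a0 /andP[].
rewrite /above -lt0n a0 /= => b12 bw.
apply: (@cons_prods _ b w [:: 1; 2]); first by rewrite !inE.
by apply: IH bw; case/orP: b12 => /eqP->.
Qed.

Section Count.

Variable n : nat.
Local Notation point := {ffun 'I_n -> 'I_4}.
Implicit Types (q : {ffun point -> 'I_4}).

Definition set_of (s : bitseq) : {set 'I_n} := [set i : 'I_n | nth false s i].

Lemma set_of_onto T : exists2 s, size s = n & set_of s = T.
Proof.
exists (mkseq (fun k => if insub k is Some i then i \in T else false) n).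
  by rewrite size_mkseq.
by apply/setP => i; rewrite inE nth_mkseq // valK.
Qed.

Lemma set_of_proper s t : size s = n -> size t = n -> subbits s t ->
  set_of s \proper set_of t.
Proof.
move=> sn tn /andP[st ne].
have imp i : nth false s i -> nth false t i.
  move: st; rewrite all2E sn tn eqxx /= => /(all_nthP (false, false)) h si.
  have [iN|iN] := ltnP i n; last by rewrite nth_default ?sn in si.
  have := h i; rewrite nth_zip ?sn ?tn // size_zip sn tn minnn si /= => -> //.
rewrite properEneq; apply/andP; split; last by apply/subsetP => i; rewrite !inE => /imp.
apply: contraNneq ne => /setP e; apply/eqP/(@eq_from_nth _ false); first by rewrite sn.
by rewrite sn => i iN; have := e (Ordinal iN); rewrite !inE.
Qed.

(** Translation by the value at the origin makes the axis fix 0, so the rest is one of the 6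
    permutations of 1, 2, 3. *)
Definition axis_perm q (i : 'I_n) : seq nat :=
  [seq (xor4 (q (upd (origin n) i (inord a))) (q (origin n)) : nat) | a <- iota 1 3].

Definition invariants q : 'I_4 * (seq (seq nat) * seq (seq nat)) :=
  (q (origin n), ([seq axis_perm q i | i <- enum 'I_n],
   [seq [seq code q (set_of s) | s <- c] | c <- chains n])).

Lemma axis_perm_in q i : is_quasigroup q -> axis_perm q i \in permutations (iota 1 3).
Proof.
move=> qq; rewrite mem_permutations.
pose f a := (xor4 (q (upd (origin n) i (inord a))) (q (origin n)) : nat).
have fI a b : a < 4 -> b < 4 -> f a = f b -> a = b.
  move=> a4 b4 /val_inj/xor4_inj/(quasiP qq)/(congr1 (@nat_of_ord _)).
  by rewrite !inordK.
have f0 : f 0 = 0.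
  rewrite /f (_ : inord 0 = ord0); last by apply: val_inj; rewrite /= inordK.
  by rewrite upd_origin0 xor4vv.
have pI : uniq (axis_perm q i).
  rewrite map_inj_in_uniq ?iota_uniq // => a b.
  rewrite !mem_iota => /andP[_ a4] /andP[_ b4].
  exact: fI.
apply: uniq_perm; rewrite ?iota_uniq //.
apply: (uniq_min_size pI _ _).2; last by rewrite size_map.
move=> v /mapP[a]; rewrite !mem_iota => /andP[a1 a4] ->.
apply/andP; split; last exact: ltn_ord.
by rewrite lt0n; apply: contraTneq a1 => fa0; rewrite (fI a 0) ?f0.
Qed.

Lemma invariants_inj : {in [pred q | is_quasigroup q] &, injective invariants}.
Proof.
move=> q q' qq qq' [o ax cd]; apply: code_inj => //; last first.
  move=> T; have [s sn <-] := set_of_onto T.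
  have [c cC sc] := mem_chains sn.
  by move/eq_in_map: cd => /(_ c cC)/eq_in_map/(_ s sc).
move=> i a; have [->|a0] := eqVneq a ord0; first by rewrite !upd_origin0 o.
move/eq_in_map: ax => /(_ i); rewrite mem_enum => /(_ isT)/eq_in_map/(_ (a : nat)).
rewrite ord4_iota_gt0 // => /(_ isT)/val_inj; rewrite inord_val o => /xor4_inj//.
Qed.

Definition possible_invariants : seq ('I_4 * (seq (seq nat) * seq (seq nat))) :=
  [seq (a, w) | a <- enum 'I_4,
    w <- [seq (u, v) | u <- prods [seq permutations (iota 1 3) | i <- enum 'I_n],
                       v <- prods [seq words (size c) | c <- chains n]]].

Lemma invariants_in q : is_quasigroup q -> invariants q \in possible_invariants.
Proof.
move=> qq; apply: allpairs_f; first by rewrite mem_enum.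
apply: allpairs_f; apply: map_in_prods; first by move=> i _; apply: axis_perm_in.
move=> c cC.
have [_ _ cs cn] := chainsP cC.
rewrite -[size c](size_map (fun s => code q (set_of s))); apply: words_complete; last first.
  by rewrite all_map; apply/allP => s _; apply: code_lt4.
rewrite sorted_map; apply: sub_in_sorted cn cs => s t /eqP sn /eqP tn st.
by apply/implyP; apply: code_above; apply: set_of_proper.
Qed.

Lemma Q_bound : Q n <= 4 * 6 ^ n * 3 ^ 'C(n, n %/ 2) * 2 ^ (2 ^ n).
Proof.
rewrite /Q cardE -(size_map invariants).
apply: (@leq_trans (size possible_invariants)).
  apply: uniq_leq_size; last first.
    by move=> v /mapP[q]; rewrite mem_enum inE => qq ->; apply: invariants_in.
  rewrite map_inj_in_uniq ?enum_uniq // => q q'.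
  by rewrite !mem_enum !inE; apply: invariants_inj.
rewrite !size_allpairs !size_prods -cardE card_ord !big_map -!mulnA.
rewrite leq_mul2l /=; apply: leq_mul.
  by rewrite big_const_seq count_predT -enumT size_enum_ord iter_muln_1.
(* Each chain contributes at most 3 * 2^size; the number of chains is the central binomial
   coefficient and their sizes add up to 2^n. *)
rewrite -size_chains -(sumn_size_chains n).
elim: (chains n) => [|c C IH]; first by rewrite big_nil.
rewrite big_cons expnS /= expnD mulnACA; apply: leq_mul IH.
exact: size_words.
Qed.

End Count.

(** * Estimates of central binomial coefficients *)

Lemma central_bin_step m :
  m.+1 * 'C(m.+1.*2, m.+1) = 2 * m.*2.+1 * 'C(m.*2, m).
Proof.
have h1 := mul_bin_diag m.+1.*2 m; have h2 := mul_bin_down m.*2.+1 m.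
rewrite /= in h1 h2.
have e : m.*2.+1 - m = m.+1 by lia.
rewrite e in h2; rewrite -h1 doubleS.
apply/eqP; rewrite -(eqn_pmul2l (ltn0Sn m)); apply/eqP.
rewrite mulnCA -h2; lia.
Qed.

(** The factor [m.*2.+1] closes the induction, through (2m + 1)(2m + 3) <= 4 (m + 1)^2. *)
Lemma central_bin_even m : 'C(m.*2, m) ^ 2 * m.*2.+1 <= 4 ^ m.*2.
Proof.
elim: m => // m IH.
rewrite -(@leq_pmul2l (m.+1 ^ 2)) // mulnA -expnMn central_bin_step doubleS !expnS.
move: IH; set c := 'C(_, _); set f := 4 ^ _ => IH.
apply: (@leq_trans (4 * (m.*2.+1 * m.*2.+3) * (c ^ 2 * m.*2.+1))).
  by rewrite !expnS !expn0; lia.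
apply: (@leq_trans (4 * (m.*2.+1 * m.*2.+3) * f)); first by rewrite leq_mul2l IH orbT.
have : m.*2.+1 * m.*2.+3 <= 4 * m.+1 ^ 2 by rewrite !expnS expn0; nia.
rewrite !expnS !expn0; nia.
Qed.

Lemma central_bin_bound n : 'C(n, n %/ 2) ^ 2 * n <= 4 ^ n.
Proof.
rewrite divn2 -[X in _ * X <= 4 ^ X](odd_double_half n) -[X in 'C(X, _)](odd_double_half n).
case: (odd n); rewrite ?add0n ?add1n; set m := n./2; last first.
  by apply: leq_trans (central_bin_even m); rewrite leq_mul2l leqnSn orbT.
have h := central_bin_even m.+1.
have e : 'C(m.+1.*2, m.+1) = 2 * 'C(m.*2.+1, m).
  rewrite doubleS binS -(@bin_sub m.*2.+1 m); last lia.
  have -> : m.*2.+1 - m = m.+1 by lia.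
  by rewrite mul2n addnn.
move: h; rewrite e expnMn doubleS [4 ^ m.*2.+2]expnS.
by set c := 'C(_, _) ^ 2; set f := 4 ^ _; lia.
Qed.

(** This is the square of n sqrt(n) <= 4 * 2^n, which controls the factor 6^n. *)
Lemma cube_bound n : n ^ 3 <= 16 * 4 ^ n.
Proof.
elim: n => // n IH.
have [|n3] := leqP n 2; first by case: n {IH} => [|[|[|]]].
rewrite [4 ^ _]expnS; apply: (@leq_trans (4 * n ^ 3)); last first.
  by rewrite mulnCA leq_mul2l IH orbT.
by rewrite !expnS !expn0; nia.
Qed.

From mathcomp Require Import all_order all_algebra.
From mathcomp Require Import all_classical all_reals all_analysis.
Import Order.TTheory GRing.Theory Num.Theory.
Import numFieldNormedType.Exports.
Local Open Scope classical_set_scope.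
Local Open Scope ring_scope.

(** * The exponent of the bound *)

Section Asymptotics.

Variable R : realType.

Lemma sqrt_le_of_nat (a b c : nat) : (a ^ 2 * c <= b ^ 2)%N ->
  a%:R * Num.sqrt (c%:R : R) <= b%:R.
Proof.
move=> h; rewrite -(ger0_norm (ler0n R b)) -sqrtr_sqr.
rewrite -{1}(ger0_norm (ler0n R a)) -sqrtr_sqr -sqrtrM ?sqr_ge0 //.
by apply: ler_wsqrtr; rewrite -!natrX -natrM ler_nat.
Qed.

(** The base 2 logarithm of all factors other than 2^(2^n), relative to 2^n. *)
Definition exponent_error n : R :=
  ln (4 * 6 ^+ n * 3 ^+ 'C(n, n %/ 2)) / ln 2 / 2 ^+ n.

Lemma bound_powR n : (4 * 6 ^ n * 3 ^ 'C(n, n %/ 2) * 2 ^ (2 ^ n))%:R =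
  2 `^ (2 ^+ n * (1 + exponent_error n)) :> R.
Proof.
have l2 : 0 < ln (2 : R) by apply: ln_gt0; rewrite ltr1n.
rewrite /exponent_error !natrM !natrX.
set M : R := 4 * 6 ^+ n * _; have M0 : 0 < M.
  by rewrite /M !mulr_gt0 ?exprn_gt0 ?ltr0n.
rewrite mulrDr mulr1 mulrCA divff ?mulr1; last by rewrite expf_neq0 ?pnatr_eq0.
rewrite /powR pnatr_eq0 /= mulrDl divfK ?gt_eqF //.
rewrite expRD lnK ?posrE // mulrC; congr (_ * _).
have -> : (2 ^+ n * ln 2 : R) = ln (2 ^+ (2 ^ n)%N).
  by rewrite lnXn ?ltr0n // -[RHS]mulr_natl natrX.
by rewrite lnK // posrE exprn_gt0 ?ltr0n.
Qed.

(** The three summands of the constant come from sqrt(n) <= 2^n, n sqrt(n) <= 4 * 2^n and the bound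
    on the central binomial coefficient, which is sharp up to a constant. *)
Lemma exponent_error_bound n : (1 <= n)%N -> 0 <= exponent_error n /\
  exponent_error n * Num.sqrt n%:R <= (ln 4 + 4 * ln 6 + ln 3) / ln 2.
Proof.
move=> n1; have l2 : 0 < ln (2 : R) by apply: ln_gt0; rewrite ltr1n.
have l3 : 0 <= ln (3 : R) by apply: ln_ge0; rewrite ler1n.
have l4 : 0 <= ln (4 : R) by apply: ln_ge0; rewrite ler1n.
have l6 : 0 <= ln (6 : R) by apply: ln_ge0; rewrite ler1n.
have p0 k m : 0 < (k.+1%:R ^+ m : R) by rewrite exprn_gt0 ?ltr0n.
rewrite /exponent_error !lnM ?posrE ?mulr_gt0 ?p0 ?ltr0n // !lnXn ?ltr0n //.
set c := 'C(_, _); split.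
  by rewrite !mulr_ge0 ?invr_ge0 ?exprn_ge0 ?(ltW l2) // !addr_ge0 ?mulrn_wge0.
set N := _ + _ *+ c; set s := Num.sqrt _.
rewrite (mulrAC _ _ s) (mulrAC N) (mulrAC (N * s)) ler_pM2r ?invr_gt0 //.
rewrite ler_pdivrMr // /N -[_ *+ n]mulr_natl -[_ *+ c]mulr_natl.
have s1 : s <= 2 ^+ n.
  rewrite -natrX -[s]mul1r; apply: (@sqrt_le_of_nat 1 _ n).
  rewrite exp1n mul1n; apply: leq_trans (ltnW (ltn_expl n (ltnSn 1))) _.
  by rewrite -expnM leq_exp2l // leq_pmulr.
have s2 : n%:R * s <= 4 * 2 ^+ n.
  rewrite -natrX -natrM; apply: sqrt_le_of_nat.
  by rewrite -expnSr expnMn -expnM [(n * 2)%N]mulnC expnM; apply: cube_bound.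
have s3 : c%:R * s <= 2 ^+ n.
  rewrite -natrX; apply: sqrt_le_of_nat.
  by rewrite -expnM [(n * 2)%N]mulnC expnM; apply: central_bin_bound.
rewrite !(mulrDl _ _ s) [leRHS]mulrDl (mulrDl (ln 4)) !lerD //.
- by rewrite ler_wpM2l.
- by rewrite mulrAC [leRHS]mulrAC ler_wpM2r.
- by rewrite mulrAC [leRHS]mulrC ler_wpM2r.
Qed.

End Asymptotics.

Theorem mainTheorem3 (R : realType) :
  (forall n : nat, (1 <= n)%N ->
     (Q n <= 4 * 6 ^ n * 3 ^ 'C(n, n %/ 2) * 2 ^ (2 ^ n))%N) /\
  (exists2 e : nat -> R,
     e =O_\oo (fun n => 1 / Num.sqrt (n%:R : R)) &
     forall n : nat, (1 <= n)%N ->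
       (4 * 6 ^ n * 3 ^ 'C(n, n %/ 2) * 2 ^ (2 ^ n))%:R
         = 2 `^ (2 ^+ n * (1 + e n)) :> R).
Proof.
split=> [n _|]; first exact: Q_bound.
exists (@exponent_error R) => [|n _]; last exact: bound_powR.
apply/eqO_exP; exists ((ln 4 + 4 * ln 6 + ln 3) / ln 2).
  rewrite divr_gt0 ?ln_gt0 ?ltr1n // !addr_gt0 ?mulr_gt0 ?ln_gt0 ?ltr1n //.
(* The threshold 1 avoids n = 0, where [1 / Num.sqrt 0] is 0 by convention but the error is
   positive. *)
exists 1%N => // n /= n1.
have [e0 eb] := exponent_error_bound R n1.
have s0 : 0 < Num.sqrt (n%:R : R) by rewrite sqrtr_gt0 ltr0n.
rewrite (ger0_norm e0) ger0_norm ?divr_ge0 ?(ltW s0) //.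
by rewrite mulrA mulr1 ler_pdivlMr.
Qed.
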